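(* Let $\mathcal S=(\mathbb P^1,x,y,\omega_{0,2})$ be a genus-zero spectral curve and let $\mathscr L_{\mathcal S}$ be its Laplace transform. Then $\mathscr L_{\mathcal S}$ has the inverse $$\mathscr L^{-1}_{\mathcal S}\Big[e^{\frac C\hbar}e^{-\frac1\hbar\int^zx\,dy}f^\vee(z;\hbar)\Big](w)=\frac{i\,e^{C/\hbar}}{\sqrt{2\pi\hbar}}\int_{\mathrm{FG}}e^{-\frac1\hbar\int^zx\,dy}\,e^{\frac{x(w)y(z)}{\hbar}}f^\vee(z;\hbar)\,y'(z)\,dz .$$
   Context: **Spectral curve.** $\mathcal S=(\mathbb P^1,x,y,\omega_{0,2})$ where $dx,dy$ are meromorphic 1-forms on $\mathbb P^1$ ($x,y$ may have logarithmic singularities), $z$ (or $w$) is an affine coordinate, and $\omega_{0,2}=\frac{dz_1dz_2}{(z_1-z_2)^2}$. Primes are derivatives with respect to the affine coordinate. **Formal Gaussian integral.** For $P\in\mathbb C[\xi][[\hbar^{1/2}]]$ and $a\ne0$, $\int_{\mathrm{FG}}e^{-a\xi^2/2}P(\xi)\,d\xi$ is defined termwise by $\int_{\mathrm{FG}}e^{-a\xi^2/2}\xi^md\xi=(m-1)!!\sqrt{2\pi/a^{m+1}}$ for $m$ even and $0$ for $m$ odd. **Laplace transform.** Let $U,V\subset\mathbb P^1$ be open sets on which $x,y$ are holomorphic and $\mathcal M(\cdot)$ denote meromorphic functions. Define $$\mathscr L_{\mathcal S}:\ e^{\frac1\hbar\mathbb C}e^{\frac1\hbar\int y\,dx}\mathcal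 M(V)[[\hbar]]\to e^{\frac1\hbar\mathbb C}e^{-\frac1\hbar\int x\,dy}\mathcal M(U)[[\hbar]],$$ $$\mathscr L_{\mathcal S}\big[e^{\frac C\hbar}e^{\frac1\hbar\int^wy\,dx}f(w;\hbar)\big](z)=\frac{e^{C/\hbar}}{\sqrt{2\pi\hbar}}\int_{\mathrm{FG}}e^{\frac1\hbar\int^wy\,dx}e^{-\frac{x(w)y(z)}\hbar}f(w;\hbar)\,x'(w)\,dw,\qquad w\in V,\ z\in U,$$ with antiderivatives normalised so that $\int^z y\,dx+\int^z x\,dy=x(z)y(z)$. The integral over $w$ is computed by expanding the integrand at the saddle point $w=z$, with integration variable $\xi=(w-z)/\hbar^{1/2}$: the exponent is $-\frac1\hbar\int^zx\,dy$ (a constant in $\xi$), plus $\frac12x'(z)y'(z)\xi^2$, plus terms with positive powers of $\hbar^{1/2}$ whose exponential is expanded in powers of $\hbar^{1/2}$, the coefficients being polynomial in $\xi$. The integral in the inverse is computed in the same way at the saddle point $z=w$ with $\xi=(z-w)/\hbar^{1/2}$, where the quadratic term is $-\frac12x'(w)y'(w)\xi^2$. Branches of the square roots are chosen locally (near points with $x'y'\neq0$) and consistently, with $\sqrt{-x'y'}=i\sqrt{x'y'}$. *)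

(* Defs.v *)
From mathcomp Require Import all_boot all_order all_algebra.
From mathcomp Require Import complex.
From mathcomp Require Import all_classical all_reals all_analysis.

Set Implicit Arguments.
Unset Strict Implicit.
Unset Printing Implicit Defensive.

Import Order.TTheory GRing.Theory Num.Theory numFieldNormedType.Exports.
Local Open Scope ring_scope.
Local Open Scope classical_set_scope.

(* The complex numbers, at a structure through which the library's topology  *)
(* and its complex derivatives derive1 and derive1n are found.               *)
Definition Cplx (R : realType) : numClosedFieldType := R[i].

Section ComplexFunctions.
Context {R : realType}.
Local Notation C := (Cplx R).
Implicit Types (f g : C -> C) (p : C) (D : set C).

Definition holomorphic_at f p : Prop :=
  exists a : nat -> C, \forall z \near p,
    series (fun n => a n * (z - p) ^+ n) @ \oo --> f z.

Definition holomorphic_on D f : Prop := forall p, D p -> holomorphic_at f p.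

(* Meromorphic functions are total functions whose values at the poles are   *)
(* irrelevant; accordingly mero_eq compares them on punctured neighbourhoods. *)
Definition meromorphic_at f p : Prop :=
  exists n : nat, holomorphic_at (fun z => (z - p) ^+ n * f z) p.

Definition meromorphic_on D f : Prop := forall p, D p -> meromorphic_at f p.

Definition mero_eq D f g : Prop :=
  forall p, D p -> \forall z \near p^', f z = g z.

(* f(z) dz is a meromorphic 1-form on P^1; the second condition is           *)
(* meromorphy at infinity, in the coordinate t = 1/z.                        *)
Definition meromorphic_form_P1 f : Prop :=
  meromorphic_on setT f /\ meromorphic_at (fun t => - f t^-1 / t ^+ 2) 0.

End ComplexFunctions.

(* A spectral curve (P^1, x, y, omega_{0,2}).  As x and y may be multivalued *)
(* (logarithms), the data are the densities of dx and dy with respect to the *)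
(* affine coordinate; x and y themselves are chosen as local primitives, see *)
(* coordinate_branch.                                                        *)
Record spectral_curve (R : realType) := SpectralCurve {
  sc_dx : Cplx R -> Cplx R;
  sc_dy : Cplx R -> Cplx R;
  sc_omega02 : Cplx R -> Cplx R -> Cplx R;
  sc_dx_mero : meromorphic_form_P1 sc_dx;
  sc_dy_mero : meromorphic_form_P1 sc_dy;
  sc_omega02E : forall z1 z2, z1 != z2 ->
    sc_omega02 z1 z2 = ((z1 - z2) ^+ 2)^-1 }.

Section Branches.
Context {R : realType}.
Local Notation C := (Cplx R).

Definition coordinate_branch (W : set C) (form x : C -> C) : Prop :=
  holomorphic_on W x /\ mero_eq W (derive1 x) form.

(* On D: A = int y dx and B = int x dy, with A + B = x y.                    *)
Definition normalised_primitives (D : set C) (x y A B : C -> C) : Prop :=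
  [/\ holomorphic_on D A /\ holomorphic_on D B,
      forall z, D z -> derive1 A z = y z * derive1 x z,
      forall z, D z -> derive1 B z = x z * derive1 y z &
      forall z, D z -> A z + B z = x z * y z].

(* s is a branch on D of the square root of x'y', and x'y' does not vanish.  *)
Definition sqrt_branch (D : set C) (x y s : C -> C) : Prop :=
  holomorphic_on D s /\
  forall z, D z -> derive1 x z * derive1 y z != 0 /\
               s z ^+ 2 = derive1 x z * derive1 y z.

End Branches.

(* Formal power series in t = hbar^(1/2) with coefficients in C[xi], given   *)
(* by their coefficient sequences.                                           *)
Section FormalSeries.
Context {R : realType}.
Local Notation C := (Cplx R).
Implicit Types P Q h : nat -> {poly C}.

Definition ser_one : nat -> {poly C} := fun n => (n == 0%N)%:R.

Definition ser_mul P Q : nat -> {poly C} :=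
  fun n => \sum_(i < n.+1) P i * Q (n - i)%N.

Definition ser_pow P (j : nat) : nat -> {poly C} := iter j (ser_mul P) ser_one.

(* exp h when h has no constant term: only h^j with j <= n reaches t^n.      *)
Definition ser_exp h : nat -> {poly C} :=
  fun n => \sum_(j < n.+1) (j`!%:R : C)^-1 *: ser_pow h j n.

Definition sqrt2pi : C := (Num.sqrt (pi *+ 2 : R))%:C%C.

(* \int_FG e^(-a xi^2/2) xi^m dxi, where r is the chosen square root of a,   *)
(* so that sqrt(2 pi / a^(m+1)) stands for sqrt(2 pi) / r^(m+1).             *)
(* For m even the product is (m-1)!!, with (-1)!! = 1.                       *)
Definition FG_moment (r : C) (m : nat) : C :=
  if odd m then 0 else (\prod_(i < m./2) i.*2.+1)%:R * sqrt2pi / r ^+ m.+1.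

Definition FG_int (r : C) P : nat -> C :=
  fun n => \sum_(m < size (P n)) (P n)`_m * FG_moment r m.

End FormalSeries.

Section Saddle.
Context {R : realType}.
Local Notation C := (Cplx R).
Implicit Types (F Phi u : C -> C) (f : nat -> C -> C) (p r : C).

(* F(p + t xi) *)
Definition taylor F p : nat -> {poly C} :=
  fun n => (derive1n n F p / n`!%:R) *: 'X^n.

(* f(p + t xi; hbar), where f(w; hbar) = \sum_k hbar^k f_k(w), hbar = t^2    *)
Definition taylor_hbar f p : nat -> {poly C} :=
  fun n => \sum_(k < n.+1 | (k.*2 <= n)%N) taylor (f k) p (n - k.*2)%N.

(* The terms with positive powers of t in t^(-2) Phi(p + t xi).              *)
Definition higher_phase Phi p : nat -> {poly C} :=
  fun m => if m == 0%N then 0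
           else (derive1n m.+2 Phi p / m.+2`!%:R) *: 'X^(m.+2).

(* e^(-Phi(p)/hbar) \int_FG e^(Phi(w)/hbar) f(w; hbar) u(w) dxi, w = p + t xi *)
(* as a series in t, for a nondegenerate critical point p of Phi, where r is *)
(* the chosen square root of - Phi''(p).                                     *)
Definition saddle_int Phi f u p r : nat -> C :=
  FG_int r (ser_mul (ser_exp (higher_phase Phi p))
                    (ser_mul (taylor_hbar f p) (taylor u p))).

End Saddle.

(* The formal expression e^(phase/hbar) \sum_k hbar^k ampl_k.                *)
Record wave (R : realType) := Wave {
  phase : Cplx R -> Cplx R;
  ampl : nat -> Cplx R -> Cplx R }.

Section LaplaceTransform.
Context {R : realType}.
Local Notation C := (Cplx R).
Implicit Types (x y s theta : C -> C) (D : set C) (psi : wave R).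

(* e^(C/hbar) e^(theta/hbar) M(D)[[hbar]], the constant C being arbitrary    *)
Definition wave_space D theta psi : Prop :=
  (exists c : C, forall z, D z -> phase psi z = c + theta z) /\
  (forall k, meromorphic_on D (ampl psi k)).

Definition wave_eq D psi1 psi2 : Prop :=
  (forall z, D z -> phase psi1 z = phase psi2 z) /\
  (forall k, mero_eq D (ampl psi1 k) (ampl psi2 k)).

(* s is the branch of the square root of x'y'.  As dw = hbar^(1/2) dxi, the  *)
(* prefactor (2 pi hbar)^(-1/2) contributes (2 pi)^(-1/2).  At the saddle    *)
(* point w = z the second derivative of the exponent is x'(z) y'(z), whence  *)
(* the square root 'i * s z of - x'(z) y'(z).  The coefficient of hbar^k is  *)
(* that of t^(2k); odd powers of t do not occur (saddle_int_odd below).      *)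
Definition Laplace x y s psi : wave R :=
  Wave (fun z => phase psi z - x z * y z)
       (fun k z => (sqrt2pi : C)^-1 *
          saddle_int (fun w => phase psi w - x w * y z) (ampl psi) (derive1 x)
                     z ('i * s z) k.*2).

Definition Laplace_inv x y s psi : wave R :=
  Wave (fun w => phase psi w + x w * y w)
       (fun k w => 'i / sqrt2pi *
          saddle_int (fun z => phase psi z + x w * y z) (ampl psi) (derive1 y)
                     w (s w) k.*2).

End LaplaceTransform.

Section Parity.
Context {R : realType}.
Local Notation C := (Cplx R).

Let homog (P : nat -> {poly C}) := forall n m, odd (n + m) -> (P n)`_m = 0.

Let homog_mul P Q : homog P -> homog Q -> homog (ser_mul P Q).
Proof.
move=> hP hQ n m onm; rewrite coef_sum big1// => i _.
rewrite coefM big1// => j _; have [oij|eij] := boolP (odd (i + j)).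
  by rewrite hP// mul0r.
rewrite hQ ?mulr0//.
have iln : (i <= n)%N by rewrite -ltnS.
have jlm : (j <= m)%N by rewrite -ltnS.
move: onm eij; rewrite !oddD !oddB//.
by case: (odd n) (odd m) (odd i) (odd j) => [] [] [] [].
Qed.

Let homog_taylor (F : C -> C) p : homog (taylor F p).
Proof.
move=> n m; rewrite coefZ coefXn; case: eqP => [->|_ _]; last by rewrite mulr0.
by rewrite addnn odd_double.
Qed.

Lemma saddle_int_odd (Phi : C -> C) (f : nat -> C -> C) (u : C -> C) (p r : C)
  (n : nat) : odd n -> saddle_int Phi f u p r n = 0.
Proof.
move=> on; rewrite /saddle_int; set P := ser_mul _ _.
suff hP : homog P.
  rewrite /FG_int big1// => m _; rewrite /FG_moment; case: ifPn => om.
    by rewrite mulr0.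
  by rewrite hP ?mul0r// oddD on (negbTE om).
apply: homog_mul.
  suff hpow j : homog (ser_pow (higher_phase Phi p) j).
    move=> k m okm; rewrite coef_sum big1// => j _.
    by rewrite coefZ hpow ?mulr0.
  elim: j => [|i IH] k m okm.
    rewrite /= /ser_one; case: k okm => [|k] okm; last by rewrite coef0.
    by rewrite coef1; case: m okm.
  apply: homog_mul okm => // a b oab; rewrite /higher_phase.
  case: eqP => _; first by rewrite coef0.
  rewrite coefZ coefXn; case: eqP oab => [->|_ _]; last by rewrite mulr0.
  by rewrite oddD /= negbK addbb.
apply: homog_mul => [k m okm|]; last exact: homog_taylor.
rewrite coef_sum big1// => i ilk; apply: homog_taylor.
by move: okm; rewrite !oddD oddB// odd_double addbF.
Qed.

End Parity.

(* Main.v *)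
Require Import Defs.
From mathcomp Require Import all_boot all_order all_algebra.
From mathcomp Require Import complex ring zify.
From mathcomp Require Import all_classical all_reals all_analysis.

(* The composition T of the Laplace transform L with its candidate inverse is
   linear over C[[hbar]].  Integrating by parts in xi, differentiating in the
   saddle point z, and rescaling t = hbar^(1/2) show that L turns
   multiplication by x into -hbar d/dy, turns hbar d/dx into multiplication by
   y, and intertwines the Euler operators of both sides.  Hence T
   commutes with multiplication by x; as F - F(w) is divisible by x - x(w), it
   commutes with every holomorphic function and is multiplication by a series
   tau = sum_k hbar^k tau_k.  It also commutes with hbar^2 d/dhbar - A, so
   k tau_k = 0, and the leading Gaussian term gives tau_0 = 1.  The other
   composition is the same assertion for the curve (y, -x). *)

Set Implicit Arguments.
Unset Strict Implicit.
Unset Printing Implicit Defensive.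

Import Order.TTheory GRing.Theory Num.Theory numFieldNormedType.Exports.
Local Open Scope ring_scope.
Local Open Scope classical_set_scope.

(** * Power series over the complex numbers *)

(** Verifying the inversion directly would need a formal Gaussian integral in two variables, with
    Fubini and a change of variables. With commutation relations every step involves a single
    integral in one variable. The exponent carries 1/hbar, so each relation is multiplied by a power
    of t to clear it; this is the origin of the shifts [sh], and it is why a relation read at order
    k + 1 constrains order k. The constant comes from the leading term: without prefactors the two
    transforms compose to 2 pi / i, which the prefactors i / sqrt(2 pi) and 1 / sqrt(2 pi) cancel.

    The relations are proved for holomorphic amplitudes on a neighbourhood, since the outer
    transform differentiates the inner one. The poles of meromorphic amplitudes may accumulate at a
    point as k grows, so no punctured neighbourhood need serve all k. Coefficient k of a transform,
    however, depends only on the amplitudes of index at most k, and truncation leads back to the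
    holomorphic case. *)

Section PowerSeries.
Context {R : realType}.
Local Notation C := (Cplx R).
Implicit Types (a b u v : nat -> C) (f g : C -> C) (p q z h K M l : C).

Lemma cplx_lt_nat (z : C) : exists n : nat, `|z| < n%:R.
Proof.
have [r rE] : exists r : R, `|z| = r%:C%C by eexists; exact: normc_def.
exists (Num.bound `|r|); rewrite rE -(rmorph_nat (real_complex R)) ltcR.
exact: le_lt_trans (ler_norm r) (archi_boundP (normr_ge0 r)).
Qed.

(** Ratios are kept at most 1/2 throughout: a geometric tail is then at most twice its first term,
    and radii are shrunk accordingly. *)
Lemma geometric_small (K rho eps : C) : 0 <= rho -> rho <= 2^-1 -> 0 <= K ->
  0 < eps -> \forall n \near \oo, K * rho ^+ n < eps.
Proof.
move=> rho0 rho2 K0 eps0; have [N KN] := cplx_lt_nat (K / eps).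
have KeN : K / eps < N%:R by rewrite -(ger0_norm (divr_ge0 K0 (ltW eps0))).
exists N => // n /= Nn.
apply: (@le_lt_trans _ _ (K * 2^-1 ^+ n)).
  by rewrite ler_wpM2l// lerXn2r ?nnegrE ?invr_ge0.
rewrite exprVn ltr_pdivrMr ?exprn_gt0// mulrC -ltr_pdivrMr//.
apply: lt_le_trans KeN _; rewrite -natrX ler_nat (leq_trans Nn)//.
exact: ltnW (ltn_expl _ _).
Qed.

Lemma series_tail_le u K rho N m : 0 <= rho -> rho <= 2^-1 -> 0 <= K ->
  (forall n, `|u n| <= K * rho ^+ n) -> (N <= m)%N ->
  `|series u m - series u N| <= 2 * K * rho ^+ N.
Proof.
move=> rho0 rho2 K0 uK Nm.
(* The subtracted term lets the induction close: rho <= 1/2 gives K rho^m <= 2 K rho^m - 2 K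
   rho^(m+1). *)
suff: `|series u m - series u N| <= 2 * K * rho ^+ N - 2 * K * rho ^+ m.
  by move/le_trans; apply; rewrite gerBl// !mulr_ge0 ?exprn_ge0.
elim: m Nm => [|m IH]; first by rewrite leqn0 => /eqP->; rewrite !subrr normr0.
rewrite leq_eqVlt => /predU1P[->|]; first by rewrite !subrr normr0.
rewrite ltnS => /IH {}IH; rewrite seriesSr addrAC.
apply: le_trans (ler_normD _ _) _; apply: le_trans (lerD IH (uK m)) _.
rewrite -addrA lerD2l -subr_ge0.
rewrite (_ : _ - _ = 2 * K * rho ^+ m * (2^-1 - rho)); last by rewrite exprS; field.
by rewrite !mulr_ge0 ?exprn_ge0 ?subr_ge0.
Qed.

Lemma cvg_geometric_bound (u : nat -> C) l K rho :
  0 <= rho -> rho <= 2^-1 -> 0 <= K ->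
  (forall n, `|l - u n| <= K * rho ^+ n) -> u @ \oo --> l.
Proof.
move=> rho0 rho2 K0 uK; apply/cvgrPdist_lt => eps eps0.
have := geometric_small rho0 rho2 K0 eps0; apply: filterS => n.
exact: le_lt_trans.
Qed.

Lemma series_cvg_bound u l K rho N : 0 <= rho -> rho <= 2^-1 -> 0 <= K ->
  (forall n, `|u n| <= K * rho ^+ n) -> series u @ \oo --> l ->
  `|l - series u N| <= 2 * K * rho ^+ N.
Proof.
move=> rho0 rho2 K0 uK ul; apply/ler_addgt0Pr => eps eps0.
move/cvgrPdist_lt : ul => /(_ _ eps0)[m _ um].
have := um (maxn N m) (leq_maxr _ _) => {}um.
have -> : l - series u N = (series u (maxn N m) - series u N)
    + (l - series u (maxn N m)) by ring.
apply: le_trans (ler_normD _ _) _; apply: lerD (ltW um).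
exact: (series_tail_le _ _ _ uK (leq_maxl _ _)).
Qed.

Lemma cvg_Re_Im (u : nat -> C) (r i : R) :
  (fun n => complex.Re (u n)) @ \oo --> r ->
  (fun n => complex.Im (u n)) @ \oo --> i -> u @ \oo --> (Complex r i : C).
Proof.
move=> /cvgrPdist_lt ur /cvgrPdist_lt ui; apply/cvgrPdist_lt => eps eps0.
have epsE : eps = (complex.Re eps)%:C%C by rewrite RRe_real// gtr0_real.
have e0 : 0 < complex.Re eps / 2 by rewrite divr_gt0// -ltcR -epsE.
have {ur ui} := (ur _ e0, ui _ e0) => -[ur ui].
near=> n.
have -> : (Complex r i : C) - u n = ((r - complex.Re (u n))%:C%C : C) +
    'i%C * (i - complex.Im (u n))%:C%C.
  by case: (u n) => a b; apply/eqP; rewrite eq_complex /=; apply/andP; split; apply/eqP; ring.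
apply: le_lt_trans (ler_normD _ _) _; rewrite normrM.
rewrite normCi mul1r [X in _ < X]epsE (splitr (complex.Re eps)).
have nr (t : R) : `|t%:C%C : C| = `|t|%:C%C.
  by rewrite normc_def /= expr0n addr0 sqrtr_sqr.
by rewrite !nr -rmorphD ltcR ltrD//; near: n.
Unshelve. all: by end_near. Qed.

(** Completeness is used over the reals: the real and imaginary parts are dominated by a geometric
    series and converge absolutely. *)
Lemma series_geometric_cvg u K rho : 0 <= rho -> rho <= 2^-1 -> 0 <= K ->
  (forall n, `|u n| <= K * rho ^+ n) -> exists l, series u @ \oo --> l.
Proof.
move=> rho0 rho2 K0 uK.
have [k kE] : exists k : R, K = k%:C%C.
  by exists (complex.Re K); rewrite RRe_real// ger0_real.
have [r rE] : exists r : R, rho = r%:C%C.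
  by exists (complex.Re rho); rewrite RRe_real// ger0_real.
have r0 : 0 <= r by rewrite -lecR -rE.
have k0 : 0 <= k by rewrite -lecR -kE.
have r2 : r <= 2^-1 by rewrite -lecR -rE fmorphV rmorph_nat.
have r1 : `|r| < 1 by rewrite ger0_norm// (le_lt_trans r2)// invf_lt1 ?ltr1n.
have cv (w : nat -> R) : (forall n, `|w n|%:C%C <= `|u n|) -> cvgn (series w).
  move=> wu; apply: normed_cvg.
  apply: (@series_le_cvg _ _ (geometric k r)) => //.
  - by move=> n /=.
  - by move=> n /=; rewrite mulr_ge0 ?exprn_ge0.
  - move=> n /=; rewrite -lecR; apply: le_trans (wu n) _.
    by rewrite rmorphM rmorphXn /= -rE -kE.
  - exact: is_cvg_geometric_series.
have /cvg_ex[/= lr clr] := cv (fun n => complex.Re (u n)) (fun n => normc_ge_Re _).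
have im n : `|complex.Im (u n)|%:C%C <= `|u n|.
  by have := normc_ge_Re (u n * 'i%C); rewrite ReiNIm normrN normrM normCi mulr1.
have /cvg_ex[/= li cli] := cv (fun n => complex.Im (u n)) im.
exists (Complex lr li); apply: cvg_Re_Im.
  apply: cvg_trans clr; apply: near_eq_cvg; near=> n.
  by rewrite /series /= (big_morph (@complex.Re R) (id1 := 0) (op1 := +%R)) // => -[? ?] [].
apply: cvg_trans cli; apply: near_eq_cvg; near=> n.
by rewrite /series /= (big_morph (@complex.Im R) (id1 := 0) (op1 := +%R)) // => -[? ?] [].
Unshelve. all: by end_near. Qed.

(** * Functions given near a point by a power series *)

Definition psum a h l := series (fun n => a n * h ^+ n) @ \oo --> l.

(** Stands in for a radius of convergence of at least 1/M. *)
Definition geo a K M := forall n, `|a n| <= K * M ^+ n.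

Definition hasps a p f := \forall z \near p, psum a (z - p) (f z).

(** Convergence at the single point p + e/2 suffices: the terms there tend to 0, hence are bounded.
    So M = 2/e, while K adds up the finitely many terms not yet known to be below 1. *)
Lemma hasps_geo a p f : hasps a p f -> exists K M, [/\ 0 < K, 0 < M & geo a K M].
Proof.
move=> /nbhs_ballP[e /= e0 ef].
have h0 : 0 < e / 2 by rewrite divr_gt0.
have /ef cf : ball p e (p + e / 2).
  rewrite -ball_normE /= opprD addNKr normrN ger0_norm ?ltW//.
  by rewrite ltr_pdivrMr// ltr_pMr// ltr1n.
rewrite addrAC subrr add0r in cf.
have /cvgr0Pnorm_lt /(_ 1 ltr01)[N _ uN] := cvg_series_cvg_0 (cvgP _ cf).
exists (1 + \sum_(i < N) `|a i * (e / 2) ^+ i|), (e / 2)^-1.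
have S0 (P : pred 'I_N) : 0 <= \sum_(i < N | P i) `|a i * (e / 2) ^+ i| by apply: sumr_ge0.
split; rewrite ?invr_gt0 ?ltr_wpDr// => n.
have -> : `|a n| = `|a n * (e / 2) ^+ n| / (e / 2) ^+ n.
  by rewrite normrM normrX (ger0_norm (ltW h0)) mulfK// expf_neq0// gt_eqF.
rewrite exprVn ler_wpM2r ?invr_ge0 ?exprn_ge0 ?(ltW h0)//.
have [nN|Nn] := ltnP n N; last by apply: ler_wpDr => //; apply: ltW (uN _ Nn).
by rewrite (bigD1 (Ordinal nN))//= addrCA ler_wpDr// ler_wpDr.
Qed.

Lemma psum_cvg a h K M : geo a K M -> 0 <= K -> 0 <= M -> M * `|h| <= 2^-1 ->
  exists l, psum a h l.
Proof.
move=> aK K0 M0 Mh; apply: (series_geometric_cvg (rho := M * `|h|) _ Mh K0).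
  by rewrite mulr_ge0.
by move=> n; rewrite normrM normrX exprMn mulrA ler_wpM2r// exprn_ge0.
Qed.

Lemma psum_bound a h l K M N : geo a K M -> 0 <= K -> 0 <= M ->
  M * `|h| <= 2^-1 -> psum a h l ->
  `|l - \sum_(i < N) a i * h ^+ i| <= 2 * K * (M * `|h|) ^+ N.
Proof.
move=> aK K0 M0 Mh al.
have := series_cvg_bound N _ Mh K0 _ al; rewrite /series /= big_mkord; apply.
  by rewrite mulr_ge0.
by move=> n; rewrite normrM normrX exprMn mulrA ler_wpM2r// exprn_ge0.
Qed.

Lemma near_mul_norm_le p M eps : 0 < M -> 0 < eps ->
  \forall z \near p, M * `|z - p| <= eps.
Proof.
move=> M0 eps0; apply/nbhs_ballP; exists (eps / M); rewrite /= ?divr_gt0//.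
move=> z; rewrite -ball_normE /= distrC => /ltW.
by rewrite ler_pdivlMr// mulrC.
Qed.

Lemma psum_unique a h l l' : psum a h l -> psum a h l' -> l = l'.
Proof. by move=> h1 h2; exact: (cvg_unique _ h1 h2). Qed.

Lemma psum0 a l : psum a 0 l -> l = a 0%N.
Proof.
move/psum_unique; apply; apply/cvgrPdist_lt => eps eps0; exists 1%N => // -[//|n] _ /=.
rewrite /series /= big_nat_recl// expr0 mulr1 big1 ?addr0 ?subrr ?normr0//.
by move=> i _; rewrite expr0n mulr0.
Qed.

Lemma hasps_val a p f : hasps a p f -> f p = a 0%N.
Proof. by move/nbhs_singleton; rewrite subrr => /psum0. Qed.

Lemma hasps_is_derive a p f : hasps a p f -> is_derive p (1 : C) f (a 1%N).
Proof.
move=> af; have [K [M [K0 M0 aK]]] := hasps_geo af.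
have key : h^-1 *: (f (h + p) - f p) @[h --> (0 : C)^'] --> a 1%N.
  apply/cvgrPdist_lt => eps eps0.
  have n1 := near_mul_norm_le 0 M0 (_ : 0 < 2^-1 :> C).
  have KM : 0 < 2 * K * M ^+ 2 by rewrite !mulr_gt0 ?exprn_gt0.
  have n2 := near_mul_norm_le 0 KM (_ : 0 < eps / 2).
  have fp := hasps_val af; move: af; rewrite /hasps (near_shift 0 p) => af.
  near=> h.
  have h0 : h != 0 by near: h; exact: nbhs_dnbhs_neq.
  have fh : psum a h (f (h + p)).
    have : psum a (shift (p - 0) h - p) (f (shift (p - 0) h)).
      by near: h; apply: nbhs_dnbhs.
    by rewrite /= subr0 addrK.
  have Mh : M * `|h| <= 2^-1.
    by rewrite -(subr0 h); near: h; apply: nbhs_dnbhs; apply: n1; rewrite invr_gt0.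
  (* The second-order remainder bounds the error of the difference quotient by 2 K M^2 |h|. *)
  have := psum_bound 2 aK (ltW K0) (ltW M0) Mh fh.
  rewrite big_ord_recr big_ord1/= expr0 mulr1 expr1 -fp => H.
  have -> : a 1%N - h^-1 *: (f (h + p) - f p) =
      - (h^-1 * (f (h + p) - (f p + a 1%N * h))).
    by rewrite /GRing.scale /=; field.
  rewrite normrN normrM normfV mulrC ltr_pdivrMr ?normr_gt0//.
  apply: le_lt_trans H _; rewrite exprMn mulrA expr2 [_ * (_ * _)]mulrA.
  rewrite ltr_pM2r ?normr_gt0//; apply: (@le_lt_trans _ _ (eps / 2)).
    by rewrite -(subr0 h); near: h; apply: nbhs_dnbhs; apply: n2; rewrite divr_gt0.
  by rewrite ltr_pdivrMr// ltr_pMr// ltr1n.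
have E : (fun h : C => h^-1 *: (f (h *: 1 + p) - f p)) =
    (fun h => h^-1 *: (f (h + p) - f p)).
  by apply: funext => h; rewrite /GRing.scale /= mulr1.
apply: DeriveDef; first by rewrite /derivable E; apply/cvg_ex; exists (a 1%N).
by rewrite /derive E; exact: (cvg_lim _ key).
Unshelve. all: by end_near. Qed.


Lemma bin_le_exp2 n k : ('C(n, k) <= 2 ^ n)%N.
Proof.
have [nk|kn] := ltnP n k; first by rewrite bin_small.
rewrite -[2%N]/(1 + 1)%N expnDn (bigD1 (inord k)) //= inordK ?ltnS//.
by rewrite !exp1n !muln1 leq_addr.
Qed.

(** The range is padded with vanishing binomials so that it can be cut at m, whether or not m
    exceeds n. *)
Lemma exprDn_ext (c h : C) n m : (c + h) ^+ n =
  \sum_(0 <= k < m + n.+1) 'C(n, k)%:R * c ^+ (n - k) * h ^+ k.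
Proof.
rewrite addnC (big_cat_nat (leq0n _) (leq_addr m n.+1)) /=.
rewrite [X in _ = _ + X]big_nat_cond [X in _ = _ + X]big1 ?addr0; last first.
  by move=> k /andP[/andP[nk _] _]; rewrite bin_small// !mul0r.
by rewrite exprDn big_mkord; apply: eq_bigr => k _; rewrite -mulr_natl mulrA.
Qed.

Lemma cvg_series_shift u l : u 0%N = 0 -> series u @ \oo --> l ->
  series (fun n => u n.+1) @ \oo --> l.
Proof.
move=> u0 ul; have := ul; rewrite -cvg_shiftS.
apply: cvg_trans; apply: near_eq_cvg; near=> n.
by rewrite /series /= [LHS]big_nat_recl// u0 add0r.
Unshelve. all: by end_near. Qed.

Lemma cvg_sum_nat (v : nat -> nat -> C) (l : nat -> C) m :
  (forall k, v k @ \oo --> l k) ->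
  (fun n => \sum_(0 <= k < m) v k n) @ \oo --> \sum_(0 <= k < m) l k.
Proof.
move=> vl; elim: m => [|m IH].
  rewrite big_geq// (_ : (fun _ => _) = fun=> 0); first exact: cvg_cst.
  by apply/funext => n; rewrite big_geq.
rewrite (_ : (fun n => _) = (fun n => \sum_(0 <= k < m) v k n + v m n)); last first.
  by apply/funext => n; rewrite big_nat_recr.
rewrite (_ : \sum_(0 <= k < m.+1) l k = \sum_(0 <= k < m) l k + l m); last first.
  by rewrite big_nat_recr.
exact: (cvgD IH (vl m)).
Qed.

(** The new coefficients come from expanding ((q - p) + (z - q))^n. The closed form of [b 1] is
    recorded because it is f'(q), which gives the power series of the derivative around p. *)
Lemma hasps_recenter a p f : hasps a p f -> \forall q \near p,
  exists b, hasps b q f /\ psum (fun n => n.+1%:R * a n.+1) (q - p) (b 1%N).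
Proof.
move=> af; have [K [M [K0 M0 aK]]] := hasps_geo af.
have M40 : 0 < 4 * M by rewrite mulr_gt0.
have n1 := near_mul_norm_le p M40 (_ : 0 < 8^-1 :> C).
have afi := nbhs_interior af.
near=> q.
have Mc : 4 * M * `|q - p| <= 8^-1 by near: q; apply: n1; rewrite invr_gt0.
have qe : \forall z \near q, psum a (z - p) (f z) by near: q.
set c := q - p in Mc *.
pose t k n := 'C(n, k)%:R * a n * c ^+ (n - k).
have tK k n : `|t k n| <= K * (4 * M) ^+ k * 2^-1 ^+ n.
  have [nk|kn] := ltnP n k.
    by rewrite /t bin_small// !mul0r normr0 !mulr_ge0 ?exprn_ge0 ?invr_ge0// ltW.
  rewrite /t !normrM normrX ger0_norm//.
  apply: (@le_trans _ _ (2 ^+ n * (K * M ^+ n) * `|c| ^+ (n - k))).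
    by rewrite ler_wpM2r ?exprn_ge0// ler_pM// -natrX ler_nat bin_le_exp2.
  rewrite -(subnK kn) addnK; move: (n - k)%N => d.
  rewrite (_ : _ * _ * _ = K * (4 * M) ^+ k * 2^-1 ^+ k * (2 * M * `|c|) ^+ d); last first.
    rewrite -[4]/((2 * 2)%:R) natrM !exprD !exprMn exprVn; field.
    by rewrite expf_neq0// pnatr_eq0.
  rewrite exprD mulrA [leRHS]mulrAC ler_wpM2l//.
    by rewrite !mulr_ge0 ?exprn_ge0 ?invr_ge0 ?mulr_ge0 ?(ltW M0) ?(ltW K0).
  rewrite lerXn2r ?nnegrE ?invr_ge0 ?mulr_ge0 ?(ltW M0)//.
  rewrite -(ler_pM2l (_ : 0 < 2)) ?mulrA// -natrM; apply: le_trans Mc _.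
  by rewrite divff// invf_le1// ler1n.
have cvt k : exists l, series (t k) @ \oo --> l.
  apply: series_geometric_cvg (tK k); rewrite ?invr_ge0//.
  by rewrite mulr_ge0 ?exprn_ge0 ?(ltW K0)// ?ltW.
have [b bP] := choice cvt.
exists b; split; last first.
  rewrite /psum; have := cvg_series_shift _ (bP 1%N).
  rewrite (_ : (fun n => t 1%N n.+1) = (fun n => n.+1%:R * a n.+1 * c ^+ n)).
    by apply; rewrite /t bin0n !mul0r.
  by apply/funext => n; rewrite /t bin1 subn1.
have n2 := near_mul_norm_le q M0 (_ : 0 < 8^-1 :> C).
near=> z.
have Mh : M * `|z - q| <= 8^-1 by near: z; apply: n2; rewrite invr_gt0.
have fz : psum a (z - p) (f z) by near: z.
set h := z - q in Mh *.
have {}fz : psum a (c + h) (f z) by rewrite addrC /c /h addrA subrK.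
pose rho := M * (`|c| + `|h|).
have rho2 : rho <= 2^-1.
  rewrite /rho mulrDr; apply: (@le_trans _ _ (8^-1 + 8^-1)).
    apply: lerD => //; apply: le_trans Mc; rewrite -mulrA ler_peMl ?ler1n//.
    by rewrite mulr_ge0// ltW.
  rewrite (_ : 8^-1 + 8^-1 = 4^-1); last by field.
  by rewrite lef_pV2 ?posrE// ler_nat.
have rho0 : 0 <= rho by rewrite mulr_ge0 ?addr_ge0// ltW.
apply: (cvg_geometric_bound rho0 rho2 (_ : 0 <= 2 * K)).
  by rewrite mulr_ge0// ltW.
move=> m.
(* No infinite sums are exchanged: [w n] collects the binomial terms with k >= m, so it vanishes for
   n < m and is bounded by K rho^n. Its sum, the error of the m-th partial sum at q, is at most 2 K
   rho^m. *)
pose w n := a n * (c + h) ^+ n - \sum_(0 <= k < m) t k n * h ^+ k.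
have wE n : w n = a n * \sum_(m <= k < m + n.+1) 'C(n, k)%:R * c ^+ (n - k) * h ^+ k.
  rewrite /w (exprDn_ext c h n m) (big_cat_nat (leq0n m) (leq_addr _ _)) /= mulrDr.
  rewrite addrAC mulr_sumr -sumrB big1 ?add0r// => k _; rewrite /t; ring.
have wK n : `|w n| <= K * rho ^+ n.
  rewrite wE normrM exprMn mulrA ler_pM// (exprDn_ext _ _ n m).
  rewrite (big_cat_nat (leq0n m) (leq_addr _ _)) /= ler_wpDl//.
    by apply: sumr_ge0 => k _; rewrite !mulr_ge0 ?exprn_ge0.
  apply: le_trans (ler_norm_sum _ _ _) _; apply: ler_sum => k _.
  by rewrite !normrM !normrX ger0_norm.
have w0 : series w m = 0.
  rewrite /series /= big_nat_cond big1// => n /andP[/andP[_ nm] _].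
  rewrite wE big_nat_cond big1 ?mulr0// => k /andP[/andP[mk _] _].
  by rewrite bin_small ?mul0r// (leq_trans nm).
have cw : series w @ \oo --> f z - series (fun n => b n * h ^+ n) m.
  have : series (fun n => a n * (c + h) ^+ n) n -
     \sum_(0 <= k < m) series (t k) n * h ^+ k @[n --> \oo] -->
     f z - series (fun n => b n * h ^+ n) m.
    apply: (cvgB fz); apply: (cvg_sum_nat (v := fun k n => series (t k) n * h ^+ k)) => k.
    by apply: cvgMr_tmp; exact: bP.
  apply: cvg_trans; apply: near_eq_cvg; near=> n.
  rewrite /series /= /w sumrB; congr (_ - _).
  by rewrite exchange_big /=; apply: eq_bigr => k _; rewrite mulr_suml.
have := series_cvg_bound m rho0 rho2 (ltW K0) wK cw.
by rewrite w0 subr0.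
Unshelve. all: by end_near. Qed.

Lemma hasps_derive1 a p f : hasps a p f ->
  hasps (fun n => n.+1%:R * a n.+1) p (derive1 f).
Proof.
move/hasps_recenter; apply: filterS => q [b [bf]].
by rewrite derive1E; have [_ ->] := hasps_is_derive bf.
Qed.

Lemma hasps_derive1n a p f n : hasps a p f ->
  exists2 b, hasps b p (derive1n n f) &
    forall i, i`!%:R * b i = (n + i)`!%:R * a (n + i)%N.
Proof.
move=> af; elim: n => [|n [b bf bE]]; first by exists a.
eexists; first exact: hasps_derive1 bf.
by move=> i /=; rewrite mulrA -natrM mulnC -factS bE addSnnS.
Qed.

Lemma geo_le a K M K' M' : 0 <= K -> 0 <= M -> K <= K' -> M <= M' ->
  geo a K M -> geo a K' M'.
Proof.
move=> K0 M0 KK MM aK n; apply: le_trans (aK n) _.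
by rewrite ler_pM ?exprn_ge0// lerXn2r// nnegrE// (le_trans M0).
Qed.

Definition cauchy_prod a b n := \sum_(i < n.+1) a i * b (n - i)%N.

Lemma partial_cauchy_prod a b h N : \sum_(n < N) cauchy_prod a b n * h ^+ n =
  \sum_(i < N) a i * h ^+ i * \sum_(j < N - i) b j * h ^+ j.
Proof.
elim: N => [|N IH]; first by rewrite !big_ord0.
rewrite big_ord_recr /= IH [RHS]big_ord_recr /= subSnn big_ord1 expr0 mulr1.
under [in RHS]eq_bigr => i _ do rewrite (subSn (ltnW (ltn_ord i))) big_ord_recr /= mulrDr.
rewrite big_split /= -addrA; congr (_ + _).
rewrite /cauchy_prod big_ord_recr /= subnn mulrDl; congr (_ + _); last by ring.
rewrite mulr_suml; apply: eq_bigr => i _.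
have -> : h ^+ N = h ^+ i * h ^+ (N - i) by rewrite -exprD subnKC// ltnW.
ring.
Qed.

Lemma hasps_mul a b p f g : hasps a p f -> hasps b p g ->
  hasps (cauchy_prod a b) p (fun z => f z * g z).
Proof.
move=> af bg.
have [K1 [M1 [K10 M10 aK1]]] := hasps_geo af.
have [K2 [M2 [K20 M20 bK2]]] := hasps_geo bg.
pose K := K1 + K2; pose M := M1 + M2.
have K0 : 0 < K by rewrite addr_gt0.
have M0 : 0 < M by rewrite addr_gt0.
have aK : geo a K M.
  by apply: geo_le aK1; rewrite ?lerDl; exact: ltW.
have bK : geo b K M.
  by apply: geo_le bK2; rewrite ?lerDr; exact: ltW.
clearbody K M.
have n1 : \forall z \near p, M * `|z - p| <= 4^-1.
  by apply: near_mul_norm_le; rewrite ?invr_gt0.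
apply: filterS3 af bg n1 => z fz gz Mh4.
set h := z - p in Mh4 fz gz *; set q := M * `|h| in Mh4.
have q0 : 0 <= q by rewrite mulr_ge0// ltW.
have Mh2 : M * `|h| <= 2^-1 by apply: le_trans Mh4 _; rewrite lef_pV2 ?posrE ?ler_nat.
apply: (@cvg_geometric_bound _ _ (2 * K * (`|g z| + K)) (2 * q)).
- by rewrite mulr_ge0.
- rewrite -(ler_pM2l (_ : 0 < 2^-1)) ?invr_gt0// mulrA mulVf// mul1r.
  by apply: le_trans Mh4 _; rewrite -invfM -natrM.
- by rewrite !mulr_ge0 ?addr_ge0 ?(ltW K0).
move=> N; rewrite /series /= big_mkord partial_cauchy_prod.
have fB := psum_bound N aK (ltW K0) (ltW M0) Mh2 fz.
(* The partial sums of the Cauchy product run over a triangle, so each i has its own tail of g, cut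
   at N - i; every resulting term is of size q^N. *)
have -> : f z * g z - \sum_(i < N) a i * h ^+ i * (\sum_(j < N - i) b j * h ^+ j) =
    (f z - \sum_(i < N) a i * h ^+ i) * g z +
    \sum_(i < N) a i * h ^+ i * (g z - \sum_(j < N - i) b j * h ^+ j).
  rewrite mulrBl -addrA mulr_suml; congr (_ + _); rewrite -!sumrN -big_split /=.
  by apply: eq_bigr => i _; ring.
apply: le_trans (ler_normD _ _) _.
apply: (@le_trans _ _ (2 * K * q ^+ N * `|g z| + N%:R * (K * (2 * K) * q ^+ N))).
  apply: lerD; first by rewrite normrM ler_wpM2r.
  apply: le_trans (ler_norm_sum _ _ _) _.
  rewrite mulr_natl -[X in _ *+ X]card_ord -sumr_const; apply: ler_sum => i _.
  have := psum_bound (N - i) bK (ltW K0) (ltW M0) Mh2 gz; rewrite -/q => gB.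
  have -> : q ^+ N = q ^+ i * q ^+ (N - i) by rewrite -exprD subnKC// ltnW.
  rewrite normrM.
  rewrite [leRHS](_ : _ = (K * q ^+ i) * (2 * K * q ^+ (N - i))); last by ring.
  apply: ler_pM => //; rewrite normrM normrX /q exprMn mulrA.
  by rewrite ler_wpM2r ?exprn_ge0.
(* There are N such terms, and N <= 2^N is absorbed into the ratio 2 q; hence the choice q <= 1/4
   above. *)
rewrite [(2 * q) ^+ N]exprMn [leLHS](_ : _ = 2 * K * (`|g z| + N%:R * K) * q ^+ N); last by ring.
rewrite [leRHS](_ : _ = 2 * K * ((`|g z| + K) * 2 ^+ N) * q ^+ N); last by ring.
rewrite ler_wpM2r ?exprn_ge0// ler_wpM2l ?mulr_ge0 ?(ltW K0)//.
rewrite mulrDl lerD//; first by rewrite ler_peMr// -natrX ler1n expn_gt0.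
by rewrite mulrC ler_wpM2l ?(ltW K0)// -natrX ler_nat ltnW// ltn_expl.
Qed.

End PowerSeries.

(** * Holomorphic and meromorphic functions *)

Section Holomorphic.
Context {R : realType}.
Local Notation C := (Cplx R).
Implicit Types (a b u v : nat -> C) (f g : C -> C) (p q z h K M l : C).

Lemma holomorphicP f p : holomorphic_at f p -> exists a, hasps a p f.
Proof. by []. Qed.

Lemma hasps_holomorphic a p f : hasps a p f -> holomorphic_at f p.
Proof. by exists a. Qed.

Local Opaque hasps holomorphic_at.

Lemma hasps_coef a p f n : hasps a p f -> derive1n n f p / n`!%:R = a n.
Proof.
move=> /(hasps_derive1n n)[b bf /(_ 0%N)]; rewrite fact0 mul1r addn0 => bE.
by rewrite (hasps_val bf) bE mulrC mulKf// pnatr_eq0 -lt0n fact_gt0.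
Qed.

(** Coefficients n, ..., 0 of the reciprocal series, newest first: the recursion for the next one
    needs all earlier ones. *)
Fixpoint inv_coefs a (n : nat) : seq C :=
  if n is m.+1 then
    - (a 0%N)^-1 * (\sum_(i < n) a i.+1 * (inv_coefs a m)`_i) :: inv_coefs a m
  else [:: (a 0%N)^-1].

Definition inv_coef a n : C := (inv_coefs a n)`_0.

Lemma inv_coefsE a n i : (i <= n)%N -> (inv_coefs a n)`_i = inv_coef a (n - i).
Proof.
by elim: n i => [|n IH] [|i]//=; rewrite ltnS => /IH ->.
Qed.

Lemma inv_coefS a n : inv_coef a n.+1 =
  - (a 0%N)^-1 * (\sum_(i < n.+1) a i.+1 * inv_coef a (n - i)).
Proof.
rewrite {1}/inv_coef /=; congr (_ * _); apply: eq_bigr => i _.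
by rewrite inv_coefsE// -ltnS.
Qed.

Lemma cauchy_prod_inv a : a 0%N != 0 -> cauchy_prod a (inv_coef a) = fun n => (n == 0%N)%:R.
Proof.
move=> a0; apply/funext => -[|n]; rewrite /cauchy_prod.
  by rewrite big_ord1 /inv_coef /= divff.
rewrite big_ord_recl /= inv_coefS mulrA mulrN divff// mulN1r addrC.
by apply/eqP; rewrite subr_eq0; apply/eqP/eq_bigr => i _.
Qed.

(** The ratio M' = M (1 + K L), with L = |1 / a 0|, is chosen so that M K L = M' - M. The sum in the
    recursion then telescopes to M'^(n+1) - M^(n+1). *)
Lemma geo_inv_coef a K M : 0 < K -> 0 < M -> a 0%N != 0 -> geo a K M ->
  geo (inv_coef a) `|(a 0%N)^-1| (M * (1 + K * `|(a 0%N)^-1|)).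
Proof.
move=> K0 M0 a0 aK; set L := `|_|; set M' := M * _.
have L0 : 0 < L by rewrite normr_gt0 invr_eq0.
have M'0 : 0 < M' by rewrite mulr_gt0 ?addr_gt0 ?mulr_gt0.
move=> n; elim/ltn_ind: n => -[_|n IH]; first by rewrite mulr1.
rewrite inv_coefS normrM normrN ler_pM2l//.
apply: le_trans (ler_norm_sum _ _ _) _.
apply: (@le_trans _ _ (M * K * L * \sum_(i < n.+1) M' ^+ (n.+1.-1 - i) * M ^+ i)).
  rewrite mulr_sumr; apply: ler_sum => i _; rewrite normrM.
  rewrite [leRHS](_ : _ = (K * M ^+ i.+1) * (L * M' ^+ (n - i))); last first.
    by rewrite exprS /=; ring.
  by apply: ler_pM => //; apply: IH; rewrite ltnS leq_subr.
have -> : M * K * L = M' - M by rewrite /M'; ring.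
by rewrite -subrXX gerBl exprn_ge0// ltW.
Qed.

Lemma holomorphic_near f p : holomorphic_at f p ->
  \forall q \near p, holomorphic_at f q.
Proof.
move=> /holomorphicP[a /hasps_recenter]; apply: filterS => q [b [bf _]].
exact: hasps_holomorphic bf.
Qed.

Lemma holomorphic_ext f g p : (\forall z \near p, f z = g z) ->
  holomorphic_at f p -> holomorphic_at g p.
Proof.
move=> fg /holomorphicP[a af]; apply: (@hasps_holomorphic a).
Transparent hasps. by apply: filterS2 fg af => z ->. Opaque hasps.
Qed.

Lemma holomorphic_derive1 f p : holomorphic_at f p -> holomorphic_at (derive1 f) p.
Proof. by move=> /holomorphicP[a /hasps_derive1 af]; exact: hasps_holomorphic af. Qed.

Lemma holomorphic_derive1n n f p : holomorphic_at f p -> holomorphic_at (derive1n n f) p.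
Proof. by move=> hf; elim: n => [|n IH]; [exact: hf|exact: (holomorphic_derive1 IH)]. Qed.

Lemma holomorphic_is_derive f p : holomorphic_at f p ->
  is_derive p (1 : C) f (derive1 f p).
Proof.
move=> /holomorphicP[a /hasps_is_derive af]; apply: is_derive_eq (af) _.
by rewrite derive1E derive_val.
Qed.

Lemma psum_at0 a : psum a 0 (a 0%N).
Proof.
apply/cvgrPdist_lt => eps eps0; exists 1%N => // -[//|n] _ /=.
rewrite /series /= big_nat_recl// expr0 mulr1 big1 ?addr0 ?subrr ?normr0//.
by move=> i _; rewrite expr0n mulr0.
Qed.

Lemma psum_finite a N h : (forall n, (N <= n)%N -> a n = 0) ->
  psum a h (\sum_(i < N) a i * h ^+ i).
Proof.
move=> aN; apply/cvgrPdist_lt => eps eps0; exists N => // n /= Nn.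
rewrite /series /= (big_cat_nat (leq0n _) Nn)/= big_mkord.
rewrite [X in _ - (_ + X)]big_nat_cond [X in _ - (_ + X)]big1 ?addr0 ?subrr ?normr0//.
by move=> i /andP[/andP[/aN-> _] _]; rewrite mul0r.
Qed.

Lemma holomorphic_cst c p : holomorphic_at (fun=> c) p.
Proof.
pose a n := if n == 0%N then c else 0; apply: (@hasps_holomorphic a).
Transparent hasps. near=> z. Opaque hasps.
by have := @psum_finite a 1 (z - p); rewrite big_ord1 mulr1; apply; case.
Unshelve. all: by end_near. Qed.

Lemma holomorphic_id p : holomorphic_at id p.
Proof.
pose a n := if n == 0%N then p else (n == 1%N)%:R; apply: (@hasps_holomorphic a).
Transparent hasps. near=> z. Opaque hasps.
have := @psum_finite a 2 (z - p).
rewrite big_ord_recr big_ord1 /= mulr1 mul1r expr1 addrC subrK; apply.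
by case=> [|[]].
Unshelve. all: by end_near. Qed.

Local Transparent hasps.
Lemma haspsD a b p f g : hasps a p f -> hasps b p g ->
  hasps (fun n => a n + b n) p (fun z => f z + g z).
Proof.
move=> af bg; apply: filterS2 af bg => z fz gz; rewrite /psum.
have -> : series (fun n => (a n + b n) * (z - p) ^+ n) =
    (fun n => series (fun n => a n * (z - p) ^+ n) n + series (fun n => b n * (z - p) ^+ n) n).
  apply/funext => n; rewrite /series /= -big_split /=.
  by apply: eq_bigr => i _; exact: mulrDl.
exact: (cvgD fz gz).
Qed.

Local Opaque hasps.

Lemma holomorphicD f g p : holomorphic_at f p -> holomorphic_at g p ->
  holomorphic_at (fun z => f z + g z) p.
Proof. by move=> /holomorphicP[a af] /holomorphicP[b bg]; exact: hasps_holomorphic (haspsD af bg). Qed.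

Lemma holomorphicM f g p : holomorphic_at f p -> holomorphic_at g p ->
  holomorphic_at (fun z => f z * g z) p.
Proof. by move=> /holomorphicP[a af] /holomorphicP[b bg]; exact: hasps_holomorphic (hasps_mul af bg). Qed.

Lemma holomorphicN f p : holomorphic_at f p -> holomorphic_at (fun z => - f z) p.
Proof.
move=> hf; have := holomorphicM (holomorphic_cst (-1) p) hf.
by rewrite (_ : (fun z => -1 * f z) = (fun z => - f z))//; apply/funext => z; rewrite mulN1r.
Qed.

Lemma holomorphicB f g p : holomorphic_at f p -> holomorphic_at g p ->
  holomorphic_at (fun z => f z - g z) p.
Proof. by move=> hf hg; exact: (holomorphicD hf (holomorphicN hg)). Qed.

Lemma holomorphicX n f p : holomorphic_at f p -> holomorphic_at (fun z => f z ^+ n) p.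
Proof.
move=> hf; elim: n => [|n IH]; first exact: holomorphic_cst.
rewrite (_ : (fun z => _) = (fun z => f z * f z ^+ n)); first exact: (holomorphicM hf IH).
by apply/funext => z; rewrite exprS.
Qed.

Lemma holomorphic_subX n p q : holomorphic_at (fun z => (z - p) ^+ n) q.
Proof.
exact: holomorphicX (holomorphicB (holomorphic_id q) (holomorphic_cst p q)).
Qed.

Lemma holomorphicV f p : holomorphic_at f p -> f p != 0 ->
  holomorphic_at (fun z => (f z)^-1) p.
Proof.
move=> /holomorphicP[a af] fp0; have [K [M [K0 M0 aK]]] := hasps_geo af.
have a0 : a 0%N != 0 by rewrite -(hasps_val af).
have bK := geo_inv_coef K0 M0 a0 aK.
have L0 : 0 < `|(a 0%N)^-1| by rewrite normr_gt0 invr_eq0.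
have M'0 : 0 < M * (1 + K * `|(a 0%N)^-1|) by rewrite mulr_gt0 ?addr_gt0 ?mulr_gt0.
move: `|_| (M * _) bK L0 M'0 => L M' bK L0 M'0.
have n1 : \forall z \near p, M' * `|z - p| <= 2^-1.
  by apply: near_mul_norm_le; rewrite ?invr_gt0.
pose g z := xget 0 [set l | psum (inv_coef a) (z - p) l].
have bg : hasps (inv_coef a) p g.
  Transparent hasps. apply: filterS n1 => z. Opaque hasps.
  move=> /(psum_cvg bK (ltW L0) (ltW M'0)) ex.
  by rewrite /g; case: xgetP => [_ _ //|no]; case: ex => l /no.
have fg := hasps_mul af bg; rewrite (cauchy_prod_inv a0) in fg.
apply: (@hasps_holomorphic (inv_coef a)).
Transparent hasps. apply: filterS2 fg bg => z. Opaque hasps.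
move=> fgz gz.
have fg1 : f z * g z = 1.
  have one : psum (fun n : nat => (n == 0%N)%:R) (z - p)
      (\sum_(i < 1) (i == 0%N :> nat)%:R * (z - p) ^+ i) by apply: psum_finite; case.
  by rewrite (psum_unique fgz one) big_ord1 mulr1.
have fz0 : f z != 0.
  by apply/eqP => f0; move/eqP: fg1; rewrite f0 mul0r eq_sym oner_eq0.
by rewrite (_ : (f z)^-1 = g z)//; apply: (mulfI fz0); rewrite divff.
Qed.



Lemma holomorphic_factor f p : holomorphic_at f p -> f p = 0 ->
  exists2 g, holomorphic_at g p & forall z, f z = (z - p) * g z.
Proof.
move=> /holomorphicP[a af] fp0; have a0 : a 0%N = 0 by rewrite -(hasps_val af).
(* With the limit as value at p, the factorisation holds at every point, even outside the disc of
   convergence. *)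
pose g z := if z == p then a 1%N else f z / (z - p).
have gE z : f z = (z - p) * g z.
  rewrite /g; case: eqP => [->|/eqP zp]; first by rewrite fp0 subrr mul0r.
  by rewrite mulrC divfK// subr_eq0.
exists g => //; apply: (@hasps_holomorphic (fun n => a n.+1)).
Transparent hasps. apply: filterS af => z. Opaque hasps.
rewrite /g; case: eqP => [-> _|/eqP zp fz].
  by rewrite subrr; exact: (@psum_at0 (fun n => a n.+1)).
have u0 : a 0%N * (z - p) ^+ 0 = 0 by rewrite a0 mul0r.
rewrite /psum (_ : series _ =
    fun n => series (fun n => a n.+1 * (z - p) ^+ n.+1) n / (z - p)).
  exact: (cvgMr_tmp (b := (z - p)^-1) (cvg_series_shift u0 fz)).
apply/funext => n; rewrite /series /= mulr_suml; apply: eq_bigr => i _.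
by rewrite exprSr mulrA mulfK// subr_eq0.
Qed.

Lemma near_eq_derive1n n f g p : (\forall z \near p, f z = g z) ->
  \forall z \near p, derive1n n f z = derive1n n g z.
Proof.
move=> fg; elim: n => [|n /nbhs_interior]; first exact: fg.
apply: filterS => z; rewrite /interior /= => fgz.
by rewrite !derive1E; exact (@near_eq_derive C C C (derive1n n f) (derive1n n g) z 1 fgz).
Qed.

Lemma derive1n_mul f g p n : holomorphic_at f p -> holomorphic_at g p ->
  derive1n n (fun z => f z * g z) p / n`!%:R =
  \sum_(i < n.+1) (derive1n i f p / i`!%:R) * (derive1n (n - i) g p / (n - i)`!%:R).
Proof.
move=> /holomorphicP[a af] /holomorphicP[b bg]; rewrite (hasps_coef n (hasps_mul af bg)).
by apply: eq_bigr => i _; rewrite (hasps_coef _ af) (hasps_coef _ bg).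
Qed.

Lemma derive1nD f g p n : holomorphic_at f p -> holomorphic_at g p ->
  derive1n n (fun z => f z + g z) p = derive1n n f p + derive1n n g p.
Proof.
move=> /holomorphicP[a af] /holomorphicP[b bg]; have n0 : n`!%:R != 0 :> C by rewrite pnatr_eq0 -lt0n fact_gt0.
apply: (mulIf (invr_neq0 n0)); rewrite mulrDl (hasps_coef n (haspsD af bg)).
by rewrite (hasps_coef n af) (hasps_coef n bg).
Qed.

Lemma derive1n_cst n (c : C) : derive1n n.+1 (fun _ : C => c) = fun=> 0.
Proof.
elim: n => [|n IH]; first by apply/funext => z; rewrite /= derive1_cst.
by rewrite -[LHS]/(derive1 (derive1n n.+1 (fun=> c))) IH; apply/funext => z; rewrite derive1_cst.
Qed.

(** * Meromorphic functions *)

Lemma meromorphic_lift f p n m : holomorphic_at (fun z => (z - p) ^+ n * f z) p -> (n <= m)%N ->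
  holomorphic_at (fun z => (z - p) ^+ m * f z) p.
Proof.
move=> hf nm; rewrite -(subnK nm).
rewrite (_ : (fun z => _) = (fun z => (z - p) ^+ (m - n) * ((z - p) ^+ n * f z))).
  exact: (holomorphicM (holomorphic_subX _ _ _) hf).
by apply/funext => z; rewrite exprD mulrA.
Qed.

Lemma holomorphic_meromorphic f p : holomorphic_at f p -> meromorphic_at f p.
Proof.
move=> hf; exists 0%N; rewrite (_ : (fun z => _) = f)//.
by apply/funext => z; rewrite expr0 mul1r.
Qed.

Lemma meromorphicD f g p : meromorphic_at f p -> meromorphic_at g p -> meromorphic_at (fun z => f z + g z) p.
Proof.
move=> [n hf] [m hg]; exists (maxn n m).
rewrite (_ : (fun z => _) = (fun z => (z - p) ^+ maxn n m * f z + (z - p) ^+ maxn n m * g z)).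
  exact: (holomorphicD (meromorphic_lift hf (leq_maxl _ _)) (meromorphic_lift hg (leq_maxr _ _))).
by apply/funext => z; rewrite mulrDr.
Qed.

Lemma meromorphicM f g p : meromorphic_at f p -> meromorphic_at g p -> meromorphic_at (fun z => f z * g z) p.
Proof.
move=> [n hf] [m hg]; exists (n + m)%N.
rewrite (_ : (fun z => _) = (fun z => (z - p) ^+ n * f z * ((z - p) ^+ m * g z))).
  exact: (holomorphicM hf hg).
by apply/funext => z; rewrite exprD mulrACA.
Qed.

Lemma meromorphic_holomorphic_near f p : meromorphic_at f p -> \forall z \near p^', holomorphic_at f z.
Proof.
move=> [n hf]; have := nbhs_dnbhs (holomorphic_near hf).
apply: filterS2 (nbhs_dnbhs_neq p) => z zp hz.
have zpn : (z - p) ^+ n != 0 by rewrite expf_neq0// subr_eq0.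
apply: holomorphic_ext (holomorphicM (holomorphicV (holomorphic_subX n p z) zpn) hz).
apply/nbhs_ballP; exists `|z - p|; first by rewrite /= normr_gt0 subr_eq0.
move=> w; rewrite -ball_normE /= => wp.
rewrite mulKf// expf_neq0// subr_eq0; apply/eqP => wp'.
by rewrite wp' ltxx in wp.
Qed.

(** With g = (z - p)^n f, one has (z - p)^(n+1) f' = (z - p) g' - n g. The equation has to hold at p
    too, where f' carries no information; both sides are 0 there, also for n = 0. *)
Lemma meromorphic_derive1 f p : meromorphic_at f p -> meromorphic_at (derive1 f) p.
Proof.
move=> mf; have nf := meromorphic_holomorphic_near mf; case: mf => n hf.
have hp : holomorphic_at (fun z => z - p) p.
  exact: (holomorphicB (holomorphic_id p) (holomorphic_cst p p)).
exists n.+1.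
have := holomorphicB (holomorphicM hp (holomorphic_derive1 hf))
   (holomorphicM (holomorphic_cst n%:R p) hf).
apply: holomorphic_ext.
move: nf; rewrite near_withinE; apply: filterS => z hz.
have [->|zp] := eqVneq z p.
  rewrite subrr exprS !mul0r sub0r; case: n {hf} => [|n]; first by rewrite mul0r oppr0.
  by rewrite exprS !mul0r mulr0 oppr0.
have fz := holomorphic_is_derive (hz zp).
have hX : is_derive z (1 : C) (fun w : C => (w - p) ^+ n) (n%:R * (z - p) ^+ n.-1).
  have h1 : is_derive z (1 : C) (fun w : C => w - p) 1.
    apply: is_derive_eq (is_deriveB (is_derive_id _ _) (is_derive_cst p _ _)) _.
    by rewrite subr0.
  have -> : (fun w : C => (w - p) ^+ n) = (fun w : C => w - p) ^+ n.
    by apply/funext => w; rewrite exprfctE.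
  apply: is_derive_eq (is_deriveX n h1) _.
  by rewrite /GRing.scale /= mulr1.
have -> : derive1 (fun z => (z - p) ^+ n * f z) z =
    (z - p) ^+ n * derive1 f z + f z * (n%:R * (z - p) ^+ n.-1).
  by rewrite [LHS]derive1E; have [_ ->] := is_deriveM hX fz.
by case: n {hf hX} => [|n]; rewrite /= ?expr0 ?exprS; ring.
Qed.

End Holomorphic.

(** * Formal series and formal Gaussian integrals *)

Section FormalAlgebra.
Context {R : realType}.
Local Notation C := (Cplx R).
Implicit Types (P Q h : nat -> {poly C}) (c r : C) (n : nat).

(* Multiplication by the series variable, be it t or hbar. *)
Definition sh {V : zmodType} (P : nat -> V) n : V := if n is m.+1 then P m else 0.

Lemma ser_addE {V : zmodType} (P Q : nat -> V) n : (P + Q) n = P n + Q n.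
Proof. by []. Qed.

Lemma ser_oppE {V : zmodType} (P : nat -> V) n : (- P) n = - P n.
Proof. by []. Qed.

Lemma ser_scaleE {V : lmodType C} c (P : nat -> V) n : (c *: P) n = c *: P n.
Proof. by []. Qed.

Lemma deriv_Xn n : deriv 'X^n = (n%:R : C) *: 'X^(n.-1).
Proof. by rewrite derivXn scaler_nat. Qed.

Lemma mul_monom (a b : C) i j :
  (a *: 'X^i) * (b *: 'X^j) = (a * b) *: 'X^(i + j) :> {poly C}.
Proof. by rewrite -scalerAr -scalerAl scalerA exprD mulrC. Qed.

Lemma mulX_monom (a : C) i : 'X * (a *: 'X^i) = a *: 'X^(i.+1) :> {poly C}.
Proof. by rewrite -scalerAr -exprS. Qed.

(** Truncation turns a coefficient of a product of series into one of a product of polynomials over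
    [{poly C}], from which commutativity and associativity are inherited. *)
Lemma ser_mulE P Q N n : (n < N)%N ->
  ser_mul P Q n = ((\poly_(i < N) P i : {poly {poly C}}) * \poly_(i < N) Q i)`_n.
Proof.
move=> nN; rewrite coefM; apply: eq_bigr => i _.
by rewrite !coef_poly (leq_ltn_trans (leq_subr _ _) nN) (leq_trans (ltn_ord i)).
Qed.

Lemma ser_mulC P Q : ser_mul P Q = ser_mul Q P.
Proof. by apply/funext => n; rewrite !(@ser_mulE _ _ n.+1)// mulrC. Qed.

Lemma ser_mulA P Q h : ser_mul P (ser_mul Q h) = ser_mul (ser_mul P Q) h.
Proof.
have trunc P1 P2 (p : {poly {poly C}}) N n : (n < N)%N ->
    ((\poly_(i < N) ser_mul P1 P2 i) * p)`_n =
    ((\poly_(i < N) P1 i) * (\poly_(i < N) P2 i) * p)`_n.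
  move=> nN; rewrite !coefM; apply: eq_bigr => i _; congr (_ * _).
  by rewrite coef_poly ifT; [apply: ser_mulE|]; exact: (leq_trans (ltn_ord i)).
apply/funext => n; rewrite !(@ser_mulE _ _ n.+1)// trunc//.
by rewrite mulrC trunc// mulrC mulrA.
Qed.

Lemma ser_mulDl P Q h : ser_mul (P + Q) h = ser_mul P h + ser_mul Q h.
Proof.
apply/funext => n; rewrite !addrfctE /ser_mul /= -big_split /=.
by apply: eq_bigr => i _; rewrite mulrDl.
Qed.

Lemma ser_mulDr P Q h : ser_mul h (P + Q) = ser_mul h P + ser_mul h Q.
Proof. by rewrite ser_mulC ser_mulDl !(ser_mulC h). Qed.

Lemma ser_mulZl c P Q : ser_mul (c *: P) Q = c *: ser_mul P Q.
Proof.
apply/funext => n; rewrite !scalrfctE /ser_mul /= scaler_sumr.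
by apply: eq_bigr => i _; rewrite scalerAl.
Qed.

Lemma ser_mulZr c P Q : ser_mul P (c *: Q) = c *: ser_mul P Q.
Proof. by rewrite ser_mulC ser_mulZl ser_mulC. Qed.

Lemma ser_mul_shl P Q : ser_mul (sh P) Q = sh (ser_mul P Q).
Proof.
apply/funext => -[|n] /=; first by rewrite /ser_mul big_ord1 mul0r.
by rewrite {1}/ser_mul big_ord_recl mul0r add0r.
Qed.

Lemma ser_mul_shr P Q : ser_mul P (sh Q) = sh (ser_mul P Q).
Proof. by rewrite ser_mulC ser_mul_shl ser_mulC. Qed.

Lemma ser_mul1 P : ser_mul ser_one P = P.
Proof.
apply/funext => n; rewrite /ser_mul big_ord_recl mul1r subn0 big1 ?addr0// => i _.
by rewrite mul0r.
Qed.

Lemma ser_pow_low P j n : P 0%N = 0 -> (n < j)%N -> ser_pow P j n = 0.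
Proof.
move=> P0; elim: j n => // j IH n nj; rewrite /ser_pow /= /ser_mul.
rewrite big_ord_recl P0 mul0r add0r big1// => i _.
have ni : (i < n)%N by [].
by rewrite [X in _ * X]IH ?mulr0//= /bump /=; case: n nj i ni => // n nj i ni; rewrite subSS (leq_ltn_trans (leq_subr _ _)).
Qed.

Lemma ser_exp_trunc h n N : h 0%N = 0 -> (n < N)%N ->
  ser_exp h n = \sum_(j < N) (j`!%:R : C)^-1 *: ser_pow h j n.
Proof.
move=> h0 nN; rewrite /ser_exp -(big_mkord xpredT (fun j => (j`!%:R : C)^-1 *: ser_pow h j n)).
rewrite -(big_mkord xpredT (fun j => (j`!%:R : C)^-1 *: ser_pow h j n)).
rewrite [RHS](big_cat_nat (leq0n n.+1) nN)/= [X in _ = _ + X]big_nat_cond.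
rewrite [X in _ = _ + X]big1 ?addr0// => j /andP[/andP[nj _] _].
by rewrite ser_pow_low ?scaler0.
Qed.

(* [D n P P'] reads: P' is the derivative of P, a family of coefficients of   *)
(* t^n indexed by Z.  A relation rather than a function, so that it covers    *)
(* d/dxi and t d/dt, but also d/dz at a single point and, with P' ignored,    *)
(* the membership of all coefficients in a ring of functions.                 *)
Record derivation_rel (Z : Type) (D : nat -> (Z -> {poly C}) -> (Z -> {poly C}) -> Prop) := {
  der_one : D 0%N (fun=> 1) (fun=> 0);
  der_zero : forall n, D n (fun=> 0) (fun=> 0);
  der_add : forall n p p' q q', D n p p' -> D n q q' ->
    D n (fun z => p z + q z) (fun z => p' z + q' z);
  der_scale : forall n c p p', D n p p' -> D n (fun z => c *: p z) (fun z => c *: p' z);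
  der_mul : forall n m p p' q q', D n p p' -> D m q q' ->
    D (n + m)%N (fun z => p z * q z) (fun z => p' z * q z + p z * q' z) }.

Section Derivation.
Context (Z : Type) (D : nat -> (Z -> {poly C}) -> (Z -> {poly C}) -> Prop).
Context (HD : derivation_rel D).

Definition der_ser (P P' : Z -> nat -> {poly C}) : Prop :=
  forall n, D n (fun z => P z n) (fun z => P' z n).

Lemma der_sum n (N : nat) (p p' : nat -> Z -> {poly C}) :
  (forall i, (i < N)%N -> D n (p i) (p' i)) ->
  D n (fun z => \sum_(i < N) p i z) (fun z => \sum_(i < N) p' i z).
Proof.
elim: N => [|N IH] H.
  rewrite (_ : (fun z => _) = fun=> 0); last by apply/funext => z; rewrite big_ord0.
  rewrite [X in D _ _ X](_ : _ = fun=> 0); first exact: der_zero.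
  by apply/funext => z; rewrite big_ord0.
rewrite (_ : (fun z => _) = (fun z => \sum_(i < N) p i z + p N z)); last first.
  by apply/funext => z; rewrite big_ord_recr.
rewrite [X in D _ _ X](_ : _ = (fun z => \sum_(i < N) p' i z + p' N z)); last first.
  by apply/funext => z; rewrite big_ord_recr.
by apply: der_add; [exact: HD|apply: IH => i iN; apply: H; exact: ltnW|exact: H].
Qed.

Lemma der_ser_mul (P P' Q Q' : Z -> nat -> {poly C}) : der_ser P P' -> der_ser Q Q' ->
  der_ser (fun z => ser_mul (P z) (Q z))
          (fun z => ser_mul (P' z) (Q z) + ser_mul (P z) (Q' z)).
Proof.
move=> HP HQ n; rewrite [X in D _ _ X](_ : _ =
    (fun z => \sum_(i < n.+1) (P' z i * Q z (n - i)%N + P z i * Q' z (n - i)%N))); last first.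
  by apply/funext => z; rewrite addrfctE /ser_mul big_split.
apply: (@der_sum n n.+1 (fun i z => P z i * Q z (n - i)%N)
  (fun i z => P' z i * Q z (n - i)%N + P z i * Q' z (n - i)%N)) => i ni.
have -> : n = (i + (n - i))%N by rewrite subnKC.
rewrite addKn; exact: der_mul.
Qed.

Lemma der_ser_pow (h h' : Z -> nat -> {poly C}) j : der_ser h h' ->
  der_ser (fun z => ser_pow (h z) j)
          (fun z => j%:R *: ser_mul (h' z) (ser_pow (h z) j.-1)).
Proof.
move=> Hh; elim: j => [|j IH].
  move=> n; rewrite [X in D _ _ X](_ : _ = fun=> 0); last first.
    by apply/funext => z; rewrite scale0r.
  rewrite /= /ser_one; case: n => [|n]; last exact: der_zero.
  exact: der_one.
have := der_ser_mul Hh IH; congr (der_ser _ _); apply/funext => z /=.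
case: j {IH} => [|j]; first by rewrite scale0r scale1r [X in _ + X](_ : _ = 0) ?addr0//; apply/funext => n; rewrite /ser_mul big1// => i _; rewrite mulr0.
rewrite ser_mulZr ser_mulA (ser_mulC (h z)) -ser_mulA.
by rewrite -[X in X + _]scale1r -scalerDl -(natrD _ 1).
Qed.

Lemma der_ser_exp (h h' : Z -> nat -> {poly C}) : der_ser h h' -> (forall z, h z 0%N = 0) ->
  (forall z, h' z 0%N = 0) ->
  der_ser (fun z => ser_exp (h z)) (fun z => ser_mul (h' z) (ser_exp (h z))).
Proof.
move=> Hh h0 h'0 n.
rewrite [X in D _ _ X](_ : _ = (fun z => \sum_(j < n.+1)
    (j`!%:R : C)^-1 *: (j%:R *: ser_mul (h' z) (ser_pow (h z) j.-1) n))).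
  apply: (@der_sum n n.+1 (fun j z => (j`!%:R : C)^-1 *: ser_pow (h z) j n)
    (fun j z => (j`!%:R : C)^-1 *: (j%:R *: ser_mul (h' z) (ser_pow (h z) j.-1) n))).
  by move=> j _; apply: der_scale => //; exact: (der_ser_pow j Hh).
apply/funext => z; rewrite [RHS]big_ord_recl scale0r scaler0 add0r.
(* As h' has no constant term, only coefficients n - i < n of the exponential occur, so n powers
   suffice. This matches the n terms left after j / j! = 1 / (j - 1)! on the other side. *)
transitivity (\sum_(i < n.+1) \sum_(j < n) (j`!%:R : C)^-1 *: (h' z i * ser_pow (h z) j (n - i)%N)).
  rewrite {1}/ser_mul; apply: eq_bigr => i _.
  have [->|i0] := eqVneq (i : nat) 0%N.
    by rewrite h'0 mul0r big1// => j _; rewrite mul0r scaler0.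
  rewrite (@ser_exp_trunc _ _ n)//; last first.
    by rewrite ltn_subrL lt0n i0 /=; case: n i i0 => // -[[]].
  by rewrite mulr_sumr; apply: eq_bigr => j _; rewrite scalerAr.
rewrite exchange_big /=; apply: eq_bigr => j _.
rewrite /bump /= add1n add0n scalerA factS natrM invfM mulrAC mulVf ?pnatr_eq0// mul1r.
by rewrite -scaler_sumr.
Qed.

End Derivation.

(** * Formal Gaussian moments and integration by parts *)

Definition FG r (p : {poly C}) : C := \sum_(m < size p) p`_m * FG_moment r m.

Lemma FG_wide r (p : {poly C}) N : (size p <= N)%N -> FG r p = \sum_(m < N) p`_m * FG_moment r m.
Proof.
move=> pN; rewrite /FG -!(big_mkord xpredT (fun m => p`_m * FG_moment r m)).
rewrite [RHS](big_cat_nat (leq0n _) pN)/= [X in _ = _ + X]big_nat_cond.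
rewrite [X in _ = _ + X]big1 ?addr0// => j /andP[/andP[nj _] _].
by rewrite nth_default ?mul0r.
Qed.

Lemma FG_add r p q : FG r (p + q) = FG r p + FG r q.
Proof.
pose N := maxn (size p) (size q).
rewrite !(@FG_wide _ _ N) ?leq_maxl ?leq_maxr ?size_polyD// -big_split /=.
by apply: eq_bigr => i _; rewrite coefD mulrDl.
Qed.

Lemma FG_scale r c p : FG r (c *: p) = c * FG r p.
Proof.
rewrite !(@FG_wide _ _ (size p)) ?size_scale_leq// mulr_sumr.
by apply: eq_bigr => i _; rewrite coefZ mulrA.
Qed.

Lemma FG_sum r (I : Type) (s : seq I) (F : I -> {poly C}) :
  FG r (\sum_(i <- s) F i) = \sum_(i <- s) FG r (F i).
Proof.
elim: s => [|i s IH]; last by rewrite !big_cons FG_add IH.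
by rewrite !big_nil -(scale0r 0) FG_scale mul0r.
Qed.

Lemma FG_Xn r m : FG r 'X^m = FG_moment r m.
Proof.
rewrite (@FG_wide _ _ m.+1) ?size_polyXn// big_ord_recr /= big1.
  by rewrite coefXn eqxx mul1r add0r.
by move=> i _; rewrite coefXn ltn_eqF ?mul0r// ltnS ltnW.
Qed.

Lemma FG_momentSS r m : r != 0 ->
  r ^+ 2 * FG_moment r m.+2 = m.+1%:R * FG_moment r m.
Proof.
move=> r0; rewrite /FG_moment /= negbK; case: ifPn => om; first by rewrite !mulr0.
rewrite big_ord_recr /= natrM (even_halfK om) !exprS.
by field; rewrite r0 expf_neq0.
Qed.

Lemma FG_moment1 r : FG_moment r 1 = 0. Proof. by []. Qed.

(** The integrand is the total derivative of e^(-r^2 xi^2 / 2) p. On monomials this is the recursion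
    between double factorials, together with the vanishing of the first moment. *)
Lemma FG_ibp r (p : {poly C}) : r != 0 -> FG r (deriv p - r ^+ 2 *: ('X * p)) = 0.
Proof.
move=> r0; rewrite -[p]coefK poly_def raddf_sum mulr_sumr scaler_sumr -sumrB FG_sum.
rewrite big1// => i _; rewrite /= derivZ -scalerAr -exprS scalerA mulrC -scalerA -scalerBr.
rewrite FG_scale FG_add -scaleN1r !FG_scale derivXn FG_Xn -mulr_natl.
rewrite (_ : i%:R * _ = (i%:R : C) *: 'X^(i.-1)); last by rewrite mulr_natl scaler_nat.
rewrite FG_scale FG_Xn; case: (nat_of_ord i) => [|m].
  by rewrite FG_moment1 !mulr0 mul0r addr0 mulr0.
by rewrite FG_momentSS// mulN1r subrr mulr0.
Qed.

Lemma FG_intE r P n : FG_int r P n = FG r (P n). Proof. by []. Qed.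

Lemma FG_int_add r P Q : FG_int r (P + Q) = FG_int r P + FG_int r Q.
Proof. by apply/funext => n; rewrite !addrfctE !FG_intE /= FG_add. Qed.

Lemma FG_int_scale r c P : FG_int r (c *: P) = c *: FG_int r P.
Proof. by apply/funext => n; rewrite !scalrfctE !FG_intE /= FG_scale. Qed.

Lemma FG_int_sh r P : FG_int r (sh P) = sh (FG_int r P).
Proof.
by apply/funext => -[|n] //=; rewrite FG_intE /= -(scale0r 0) FG_scale mul0r.
Qed.

Definition dxi P : nat -> {poly C} := fun n => deriv (P n).

Lemma dxi_derivation :
  @derivation_rel unit (fun _ p p' => p' = fun z => deriv (p z)).
Proof.
split.
- by apply/funext => z; rewrite derivC.
- by move=> _; apply/funext => z; rewrite derivC.
- by move=> _ p p' q q' -> ->; apply/funext => z; rewrite derivD.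
- by move=> _ c p p' ->; apply/funext => z; rewrite derivZ.
- by move=> _ _ p p' q q' -> ->; apply/funext => z; rewrite derivM.
Qed.

Lemma dxi_mul P Q : dxi (ser_mul P Q) = ser_mul (dxi P) Q + ser_mul P (dxi Q).
Proof.
apply/funext => n.
have := @der_ser_mul _ _ dxi_derivation (fun=> P) (fun=> dxi P) (fun=> Q) (fun=> dxi Q).
by move=> /(_ (fun=> erefl) (fun=> erefl) n) /(congr1 (@^~ tt)) ->.
Qed.

Lemma dxi_exp h : h 0%N = 0 -> dxi (ser_exp h) = ser_mul (dxi h) (ser_exp h).
Proof.
move=> h0; apply/funext => n.
have := @der_ser_exp _ _ dxi_derivation (fun=> h) (fun=> dxi h) (fun=> erefl) (fun=> h0).
have dh0 : unit -> dxi h 0%N = 0 by rewrite /dxi h0 derivC.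
by move=> /(_ dh0 n) /(congr1 (@^~ tt)) ->.
Qed.

Definition dt P : nat -> {poly C} := fun n => n%:R *: P n.

Lemma dt_derivation :
  @derivation_rel unit (fun n p p' => p' = fun z => (n%:R : C) *: p z).
Proof.
split.
- by apply/funext => z; rewrite scale0r.
- by move=> n; apply/funext => z; rewrite scaler0.
- by move=> n p p' q q' -> ->; apply/funext => z; rewrite scalerDr.
- by move=> n c p p' ->; apply/funext => z; rewrite !scalerA mulrC.
- move=> n m p p' q q' -> ->; apply/funext => z.
  by rewrite -scalerAl -scalerAr -scalerDl natrD.
Qed.

Lemma dt_mul P Q : dt (ser_mul P Q) = ser_mul (dt P) Q + ser_mul P (dt Q).
Proof.
apply/funext => n.
have := @der_ser_mul _ _ dt_derivation (fun=> P) (fun=> dt P) (fun=> Q) (fun=> dt Q).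
by move=> /(_ (fun=> erefl) (fun=> erefl) n) /(congr1 (@^~ tt)) ->.
Qed.

Lemma dt_exp h : h 0%N = 0 -> dt (ser_exp h) = ser_mul (dt h) (ser_exp h).
Proof.
move=> h0; apply/funext => n.
have := @der_ser_exp _ _ dt_derivation (fun=> h) (fun=> dt h) (fun=> erefl) (fun=> h0).
have dh0 : unit -> dt h 0%N = 0 by rewrite /dt h0 scaler0.
by move=> /(_ dh0 n) /(congr1 (@^~ tt)) ->.
Qed.

Definition mulX P : nat -> {poly C} := fun n => 'X * P n.

Lemma mulX_mull P Q : ser_mul (mulX P) Q = mulX (ser_mul P Q).
Proof.
apply/funext => n; rewrite /ser_mul /mulX mulr_sumr.
by apply: eq_bigr => i _; rewrite mulrA.
Qed.

Lemma mulX_mulr P Q : ser_mul P (mulX Q) = mulX (ser_mul P Q).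
Proof. by rewrite ser_mulC mulX_mull ser_mulC. Qed.

Lemma dxi_mulX P : dxi (mulX P) = P + mulX (dxi P).
Proof. by apply/funext => n; rewrite addrfctE /dxi /mulX derivM derivX mul1r. Qed.

Lemma FG_int_ibp r h P : r != 0 -> h 0%N = 0 ->
  FG_int r (ser_mul (ser_exp h) (dxi P + ser_mul (dxi h) P)) =
  r ^+ 2 *: FG_int r (ser_mul (ser_exp h) (mulX P)).
Proof.
move=> r0 h0; apply/eqP; rewrite -subr_eq0 -scaleN1r scalerA -FG_int_scale -FG_int_add.
apply/eqP/funext => n; rewrite FG_intE.
have -> : ser_mul (ser_exp h) (dxi P + ser_mul (dxi h) P) = dxi (ser_mul (ser_exp h) P).
  by rewrite dxi_mul dxi_exp// ser_mulDr ser_mulA (ser_mulC (ser_exp h) (dxi h)) addrC.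
rewrite mulX_mulr -[RHS](@FG_ibp r (ser_mul (ser_exp h) P n))//.
by rewrite addrfctE scalrfctE /= mulN1r scaleNr.
Qed.

End FormalAlgebra.

(** * Saddle-point integrals *)

Section Saddle.
Context {R : realType}.
Local Notation C := (Cplx R).
Implicit Types (F G u Phi x y A s : C -> C) (f g : nat -> C -> C) (p r c : C) (n k : nat).

Local Opaque holomorphic_at.

Lemma shD {V : zmodType} (P Q : nat -> V) : sh (P + Q) = sh P + sh Q.
Proof. by apply/funext => -[|n] //; rewrite ser_addE /= addr0. Qed.

Lemma shZ {V : lmodType C} c (P : nat -> V) : sh (c *: P) = c *: sh P.
Proof. by apply/funext => -[|n] //; rewrite ser_scaleE /= scaler0. Qed.

(** * Taylor expansions at the saddle point as series in t *)

Lemma taylor_near F G p : (\forall z \near p, F z = G z) -> taylor F p = taylor G p.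
Proof.
move=> FG; apply/funext => n; rewrite /taylor.
by rewrite (nbhs_singleton (near_eq_derive1n n FG)).
Qed.

Lemma taylorM F G p : holomorphic_at F p -> holomorphic_at G p ->
  taylor (fun z => F z * G z) p = ser_mul (taylor F p) (taylor G p).
Proof.
move=> hF hG; apply/funext => n; rewrite /taylor (derive1n_mul n hF hG).
rewrite /ser_mul scaler_suml; apply: eq_bigr => i _.
by rewrite mul_monom subnKC// -ltnS.
Qed.

Lemma taylorD F G p : holomorphic_at F p -> holomorphic_at G p ->
  taylor (fun z => F z + G z) p = taylor F p + taylor G p.
Proof.
move=> hF hG; apply/funext => n; rewrite ser_addE /taylor (derive1nD n hF hG).
by rewrite mulrDl scalerDl.
Qed.

Lemma taylor_cst c p : taylor (fun=> c) p = c *: ser_one.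
Proof.
apply/funext => -[|n]; rewrite ser_scaleE /taylor /ser_one.
  by rewrite /= fact0 divr1.
by rewrite derive1n_cst mul0r scale0r scaler0.
Qed.

Lemma taylorZ c F p : holomorphic_at F p ->
  taylor (fun z => c * F z) p = c *: taylor F p.
Proof.
move=> hF; rewrite (taylorM (holomorphic_cst c p) hF) taylor_cst.
by rewrite ser_mulZl ser_mul1.
Qed.

Lemma derive1n_derive1 n F : derive1n n (derive1 F) = derive1n n.+1 F.
Proof. by rewrite /derive1n iterSr. Qed.

Lemma coef_deriv_fact n F p :
  (derive1n n.+1 F p / n.+1`!%:R) * n.+1%:R = derive1n n.+1 F p / n`!%:R.
Proof. by rewrite factS natrM invfM mulrA mulrAC mulfVK// pnatr_eq0. Qed.

Lemma dxi_taylor F p : dxi (taylor F p) = sh (taylor (derive1 F) p).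
Proof.
apply/funext => -[|n]; rewrite /dxi /taylor derivZ deriv_Xn scalerA; first by rewrite mulr0 scale0r.
by rewrite coef_deriv_fact /= derive1n_derive1.
Qed.

Lemma dt_taylor F p : dt (taylor F p) = mulX (dxi (taylor F p)).
Proof.
apply/funext => n; rewrite /dt /mulX /dxi /taylor derivZ deriv_Xn !scalerA mulX_monom mulrC.
by case: n => [|n]//; rewrite !mulr0 !scale0r.
Qed.

Lemma taylor_hbar_rec f p :
  taylor_hbar f p = taylor (f 0%N) p + sh (sh (taylor_hbar (fun k => f k.+1) p)).
Proof.
apply/funext => n; rewrite ser_addE /taylor_hbar big_mkcond big_ord_recl /= subn0.
congr (_ + _); case: n => [|[|n]] /=; first by rewrite big_ord0.
  by rewrite big1// => i _; rewrite ifF// /bump /=; lia.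
rewrite big_ord_recr /= ifF ?addr0; last by rewrite /bump /=; lia.
rewrite [RHS]big_mkcond; apply: eq_bigr => i _; rewrite /bump /= add1n.
rewrite (_ : (i.+1.*2 <= n.+2)%N = (i.*2 <= n)%N); last by lia.
by rewrite (_ : (n.+2 - i.+1.*2 = n - i.*2)%N)//; lia.
Qed.

(** The recursion X = a + t^2 X(next) determines X. With f_k replaced by f_(k+1) as the next index,
    identities for [taylor_hbar] reduce to those for the leading amplitude. *)
Lemma sh2_unique {V : zmodType} (I : Type) (P : I -> Prop) (nx : I -> I)
    (X Y a : I -> nat -> V) :
  (forall i, P i -> P (nx i)) ->
  (forall i, P i -> X i = a i + sh (sh (X (nx i)))) ->
  (forall i, P i -> Y i = a i + sh (sh (Y (nx i)))) ->
  forall i, P i -> X i = Y i.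
Proof.
move=> Pnx HX HY i Pi; apply/funext => n.
elim/ltn_ind: n i Pi => n IH i Pi; rewrite HX// HY// !ser_addE; congr (_ + _).
by case: n IH => [|[|n]] IH //=; apply: IH => //; exact: Pnx.
Qed.

Definition hol_seq f p := forall k, holomorphic_at (f k) p.

Lemma taylor_hbarM F f p : holomorphic_at F p -> hol_seq f p ->
  taylor_hbar (fun k z => F z * f k z) p = ser_mul (taylor F p) (taylor_hbar f p).
Proof.
move=> hF; move: f; apply: (@sh2_unique _ _ (fun f => hol_seq f p) (fun f k => f k.+1)
  (fun f => taylor_hbar (fun k z => F z * f k z) p) _
  (fun f => ser_mul (taylor F p) (taylor (f 0%N) p))) => [f hf k|f hf|f hf].
- exact: hf.
- by rewrite taylor_hbar_rec (taylorM hF (hf 0%N)).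
- by rewrite taylor_hbar_rec ser_mulDr !ser_mul_shr.
Qed.

Lemma taylor_hbarD f g p : hol_seq f p -> hol_seq g p ->
  taylor_hbar (fun k z => f k z + g k z) p = taylor_hbar f p + taylor_hbar g p.
Proof.
move=> hf hg; apply/funext => n; rewrite ser_addE /taylor_hbar /= -big_split /=.
by apply: eq_bigr => k _; rewrite (taylorD (hf k) (hg k)) ser_addE.
Qed.

Lemma dxi_taylor_hbar f p :
  dxi (taylor_hbar f p) = sh (taylor_hbar (fun k => derive1 (f k)) p).
Proof.
have dD P Q : dxi (P + Q) = dxi P + dxi Q :> (nat -> {poly C}).
  by apply/funext => n; rewrite !ser_addE /dxi derivD.
have dS P : dxi (sh P) = sh (dxi P) :> (nat -> {poly C}).
  by apply/funext => -[|n] //=; rewrite /dxi /= derivC.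
apply: (@sh2_unique _ _ (fun=> True) (fun f k => f k.+1)
  (fun f => dxi (taylor_hbar f p)) (fun f => sh (taylor_hbar (fun k => derive1 (f k)) p))
  (fun f => sh (taylor (derive1 (f 0%N)) p))) => // {}f _.
- by rewrite taylor_hbar_rec dD !dS dxi_taylor.
- by rewrite [in LHS]taylor_hbar_rec shD.
Qed.

Definition hshift f k : C -> C := if k is k'.+1 then f k' else fun=> 0.

Lemma taylor_hbar_hshift f p : taylor_hbar (hshift f) p = sh (sh (taylor_hbar f p)).
Proof. by rewrite taylor_hbar_rec taylor_cst scale0r add0r. Qed.

(** The variable t enters twice: through w = p + t xi, where t d/dt acts as xi d/dxi, and through
    hbar^k = t^(2k), which gives the factor 2k. *)
Lemma dt_taylor_hbar f p : hol_seq f p ->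
  dt (taylor_hbar f p) = mulX (dxi (taylor_hbar f p)) +
    2 *: taylor_hbar (fun k z => k%:R * f k z) p.
Proof.
move=> hf; apply/funext => n; rewrite ser_addE ser_scaleE /dt /mulX /dxi /taylor_hbar.
rewrite (raddf_sum deriv) /= [X in _ = X + _]mulr_sumr !scaler_sumr -big_split /=.
apply: eq_bigr => k kn.
rewrite (taylorZ _ (hf k)) ser_scaleE scalerA -natrM mul2n.
have := congr1 (@^~ (n - k.*2)%N) (dt_taylor (f k) p); rewrite /dt /mulX /dxi => <-.
by rewrite -scalerDl -natrD subnK.
Qed.

Definition saddle_series r Phi p (P : nat -> {poly C}) : nat -> C :=
  FG_int r (ser_mul (ser_exp (higher_phase Phi p)) P).

Lemma saddle_seriesD r Phi p P Q : saddle_series r Phi p (P + Q) =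
  saddle_series r Phi p P + saddle_series r Phi p Q.
Proof. by rewrite /saddle_series ser_mulDr FG_int_add. Qed.

Lemma saddle_seriesZ r Phi p c P : saddle_series r Phi p (c *: P) =
  c *: saddle_series r Phi p P.
Proof. by rewrite /saddle_series ser_mulZr FG_int_scale. Qed.

Lemma saddle_series_sh r Phi p P : saddle_series r Phi p (sh P) =
  sh (saddle_series r Phi p P).
Proof. by rewrite /saddle_series ser_mul_shr FG_int_sh. Qed.

Lemma higher_phase0 Phi p : higher_phase Phi p 0 = 0. Proof. by []. Qed.

(** The Gaussian exponent - r^2 xi^2 / 2 and the higher phase add up to t^(-2) (Phi(p + t xi) -
    Phi(p)). Its xi-derivative is t^(-1) Phi'(p + t xi), and the shift clears the denominator. *)
Lemma sh_dxi_higher_phase r Phi p : derive1 Phi p = 0 -> derive1n 2 Phi p = - r ^+ 2 ->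
  sh (dxi (higher_phase Phi p) - r ^+ 2 *: mulX ser_one) = taylor (derive1 Phi) p.
Proof.
move=> P1 P2; apply/funext => -[|[|n]].
- by rewrite /taylor /= P1 mul0r scale0r.
- rewrite /= ser_addE ser_oppE ser_scaleE /dxi /= derivC sub0r /mulX /ser_one mulr1.
  by rewrite /taylor derive1n_derive1 P2 divr1 scaleNr expr1.
rewrite [LHS]/= ser_addE ser_oppE ser_scaleE /dxi /mulX /ser_one mulr0 scaler0 subr0.
rewrite /higher_phase [n.+1 == 0%N]/= derivZ deriv_Xn scalerA.
by rewrite coef_deriv_fact /taylor derive1n_derive1.
Qed.

Lemma sh2_higher_phase r Phi p : derive1 Phi p = 0 -> derive1n 2 Phi p = - r ^+ 2 ->
  sh (sh (r ^+ 2 *: mulX (mulX ser_one) - 2 *: higher_phase Phi p)) =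
  (- 2) *: (taylor Phi p - Phi p *: ser_one).
Proof.
move=> P1 P2; apply/funext => -[|[|[|n]]]; rewrite [RHS]ser_scaleE [in RHS]ser_addE
  [in RHS]ser_oppE [in RHS]ser_scaleE /taylor [LHS]/= ?ser_addE ?ser_oppE ?ser_scaleE /ser_one.
- by rewrite fact0 divr1 subrr scaler0.
- by rewrite /= P1 mul0r scale0r scaler0 subr0 scaler0.
- rewrite /mulX /= !scaler0 !subr0 mulr1 -[derive1 (derive1 Phi)]/(derive1n 2 Phi) P2.
  by rewrite scalerA -expr2; congr (_ *: _); rewrite -[2`!%:R]/(2%:R); field.
by rewrite /mulX /= !mulr0 !scaler0 sub0r subr0 scaleNr.
Qed.

(** That is, hbar times the integral of e^(Phi/hbar) f' is minus that of e^(Phi/hbar) Phi' f. The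
    two expansions are parameters so that a caller can supply them with a factor x' split off as the
    measure. *)
Lemma saddle_ibp r Phi f p (dPhi df : nat -> {poly C}) :
  r != 0 -> derive1 Phi p = 0 -> derive1n 2 Phi p = - r ^+ 2 ->
  taylor (derive1 Phi) p = dPhi -> taylor_hbar (fun k => derive1 (f k)) p = df ->
  sh (sh (saddle_series r Phi p df)) =
  - saddle_series r Phi p (ser_mul dPhi (taylor_hbar f p)).
Proof.
move=> r0 P1 P2 <- <-; apply/eqP; rewrite -addr_eq0; apply/eqP.
rewrite -(sh_dxi_higher_phase P1 P2) ser_mul_shl -!saddle_series_sh -saddle_seriesD.
rewrite -dxi_taylor_hbar -shD saddle_series_sh.
have := @FG_int_ibp _ r (higher_phase Phi p) (taylor_hbar f p) r0 (higher_phase0 _ _).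
rewrite -!/(saddle_series _ _ _ _) => ibp.
rewrite -scaleN1r scalerA ser_mulDl ser_mulZl mulX_mull ser_mul1 addrA saddle_seriesD ibp.
rewrite saddle_seriesZ -scalerDl mulN1r subrr scale0r.
by apply/funext => -[].
Qed.

(* t d/dt acts on w = p + t xi as xi d/dxi; integrating by parts in xi turns  *)
(* the latter into multiplication by the phase.                               *)
Lemma saddle_euler r Phi f F p : r != 0 -> derive1 Phi p = 0 ->
  derive1n 2 Phi p = - r ^+ 2 -> hol_seq f p ->
  sh (sh (fun n => n.+1%:R *
     saddle_series r Phi p (ser_mul (taylor_hbar f p) (taylor F p)) n)) =
  (- 2) *: saddle_series r Phi p (ser_mul (taylor Phi p - Phi p *: ser_one)
      (ser_mul (taylor_hbar f p) (taylor F p))) +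
  2 *: sh (sh (saddle_series r Phi p
      (ser_mul (taylor_hbar (fun k z => k%:R * f k z) p) (taylor F p)))).
Proof.
move=> r0 P1 P2 hf; set Q := ser_mul (taylor_hbar f p) _.
set Qk := ser_mul _ (taylor F p).
set h := higher_phase Phi p; set E := ser_exp h.
have dtQ : dt Q = mulX (dxi Q) + 2 *: Qk.
  rewrite /Q dt_mul dt_taylor_hbar// dt_taylor dxi_mul.
  rewrite ser_mulDl ser_mulZl mulX_mull mulX_mulr -/Qk.
  rewrite addrAC; congr (_ + _).
  by apply/funext => n; rewrite !ser_addE /mulX mulrDr.
have dth : dt h = mulX (dxi h) + (- 2) *: h.
  rewrite scaleNr.
  apply/funext => -[|n]; rewrite ser_addE ser_oppE ser_scaleE /dt /mulX /dxi /h /higher_phase.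
    by rewrite eqxx derivC !scaler0 mulr0 subr0.
  rewrite [n.+1 == 0%N]/= derivZ deriv_Xn !scalerA mulX_monom -scalerBl.
  by congr (_ *: _); rewrite -(addn2 n.+1) natrD; ring.
have key : dt (ser_mul E Q) + ser_mul E Q =
    ser_mul E (dxi (mulX Q) + ser_mul (dxi h) (mulX Q)) + (- 2) *: ser_mul E (ser_mul h Q)
    + 2 *: ser_mul E Qk.
  rewrite dt_mul dt_exp// -/E dth dtQ dxi_mulX.
  clear dtQ dth; clearbody E; move: (dxi h) (dxi Q) => Dh DQ; clearbody Qk.
  rewrite !ser_mulDl !ser_mulDr !ser_mulZr !ser_mulZl !mulX_mull !mulX_mulr.
  rewrite (ser_mulC Dh E) (ser_mulC h E) -!ser_mulA.
  move: (mulX _) (mulX _) (ser_mul E (ser_mul h Q)) (ser_mul E Q) (ser_mul E Qk) => a b c d e.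
  by rewrite !addrA [LHS](ACl (5*3*1*2*4)).
have := congr1 (FG_int r) key.
rewrite !FG_int_add !FG_int_scale (FG_int_ibp _ r0 (higher_phase0 _ _)) -/h -/E => key2.
have -> : (fun n => n.+1%:R * saddle_series r Phi p Q n) =
   FG_int r (dt (ser_mul E Q)) + FG_int r (ser_mul E Q).
  apply/funext => n; rewrite ser_addE /saddle_series -/h -/E !FG_intE /dt FG_scale.
  by rewrite -natr1 mulrDl mul1r.
rewrite key2 !shD !shZ -/E -/h; congr (_ + _).
rewrite -saddle_seriesZ -ser_mulZl -(sh2_higher_phase P1 P2).
rewrite !ser_mul_shl !saddle_series_sh -!shZ -!shD; congr (sh (sh _)).
rewrite ser_mulDl ser_mulZl -scaleNr ser_mulZl !mulX_mull ser_mul1.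
by rewrite saddle_seriesD !saddle_seriesZ.
Qed.

End Saddle.

(** * Moving the saddle point *)

Section SaddleDerivative.
Context {R : realType}.
Local Notation C := (Cplx R).
Implicit Types (F G u Phi x y A r s : C -> C) (f g : nat -> C -> C) (p c : C) (n k : nat).

Local Opaque holomorphic_at derive1.

Lemma is_derive_scalel F p c d : is_derive p (1 : C) F d ->
  is_derive p (1 : C) (fun z => c * F z) (c * d).
Proof.
move=> dF; rewrite (_ : (fun z => _) = cst c * F)//.
apply: is_derive_eq (is_deriveM (is_derive_cst c p 1) dF) _.
by rewrite /GRing.scale /= mulr0 addr0.
Qed.

Lemma is_derive_mul F G p d e : is_derive p (1 : C) F d -> is_derive p (1 : C) G e ->
  is_derive p (1 : C) (fun z => F z * G z) (d * G p + F p * e).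
Proof.
move=> dF dG; rewrite (_ : (fun z => _) = F * G)//.
apply: is_derive_eq (is_deriveM dF dG) _.
by rewrite /GRing.scale /=; ring.
Qed.

Lemma is_derive_sum_ord N (F : 'I_N -> C -> C) p (d : 'I_N -> C) :
  (forall i, is_derive p (1 : C) (F i) (d i)) ->
  is_derive p (1 : C) (fun z => \sum_(i < N) F i z) (\sum_(i < N) d i).
Proof.
move=> dF; have := is_derive_sum dF.
by rewrite (_ : \sum_(i < N) F i = (fun z => \sum_(i < N) F i z))//; apply/funext => z; rewrite fct_sumE.
Qed.

(** A degree bound uniform in z makes the Gaussian integral a sum of fixed length, which can be
    differentiated term by term. *)
Definition dz_rel p (n : nat) (P P' : C -> {poly C}) : Prop :=
  exists N, [/\ forall z, (size (P z) <= N)%N, forall z, (size (P' z) <= N)%N &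
    forall m, is_derive p (1 : C) (fun z => (P z)`_m) (P' p)`_m].

Lemma dz_monom p n k (a : C -> C) (a' : C) : is_derive p (1 : C) a a' ->
  dz_rel p n (fun z => a z *: 'X^k) (fun=> a' *: 'X^k).
Proof.
move=> da; have sz (c : C) : (size (c *: 'X^k : {poly C}) <= k.+1)%N.
  by rewrite (leq_trans (size_scale_leq _ _))// size_polyXn.
exists k.+1; split=> [z|z|m]; [exact: sz|exact: sz|].
rewrite coefZ mulrC (_ : (fun z => _) = (fun z => ('X^k : {poly C})`_m * a z)).
  exact: is_derive_scalel.
by apply/funext => z; rewrite coefZ mulrC.
Qed.

Lemma dz_derivation p : derivation_rel (dz_rel p).
Proof.
split.
- have := @dz_monom p 0 0 (cst 1) 0 (is_derive_cst (1 : C) p 1).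
  by rewrite (_ : (fun z => _) = fun=> 1) ?scale0r//; apply/funext => z; rewrite scale1r.
- move=> n; have := @dz_monom p n 0 (cst 0) 0 (is_derive_cst (0 : C) p 1).
  by rewrite (_ : (fun z => _) = fun=> 0) ?scale0r//; apply/funext => z; rewrite scale0r.
- move=> n P P' Q Q' [N [PN P'N dP]] [M [QM Q'M dQ]]; exists (maxn N M).
  have sz (a b : {poly C}) : (size a <= N)%N -> (size b <= M)%N ->
      (size (a + b)%R <= maxn N M)%N.
    move=> aN bM; apply: leq_trans (size_polyD _ _) _.
    by rewrite geq_max !leq_max aN bM orbT.
  split=> [z|z|m]; [exact: sz|exact: sz|].
  rewrite coefD (_ : (fun z => _) = (fun z => (P z)`_m) + (fun z => (Q z)`_m)).
    exact: is_deriveD (dP m) (dQ m).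
  by apply/funext => z; rewrite coefD.
- move=> n c P P' [N [PN P'N dP]]; exists N; split=> [z|z|m].
  + by rewrite (leq_trans (size_scale_leq _ _)).
  + by rewrite (leq_trans (size_scale_leq _ _)).
  rewrite coefZ (_ : (fun z => _) = (fun z => c * (P z)`_m)).
    exact: (is_derive_scalel c (dP m)).
  by apply/funext => z; rewrite coefZ.
- move=> n k P P' Q Q' [N [PN P'N dP]] [M [QM Q'M dQ]]; exists (N + M)%N.
  have sz (a b : {poly C}) : (size a <= N)%N -> (size b <= M)%N -> (size (a * b)%R <= N + M)%N.
    move=> aN bM; apply: leq_trans (size_polyMleq _ _) _.
    by rewrite (leq_trans (leq_pred _))// leq_add.
  split=> [z|z|m]; first exact: sz.
    apply: leq_trans (size_polyD _ _) _; rewrite geq_max.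
    by apply/andP; split; apply: sz.
  rewrite coefD !coefM -big_split /=.
  rewrite (_ : (fun z => _) = (fun z => \sum_(i < m.+1) (P z)`_i * (Q z)`_(m - i))).
    apply: (@is_derive_sum_ord _ (fun i z => (P z)`_i * (Q z)`_(m - i))
      p (fun i => (P' p)`_i * (Q p)`_(m - i) + (P p)`_i * (Q' p)`_(m - i))) => i.
    exact: (is_derive_mul (dP i) (dQ (m - i)%N)).
  by apply/funext => z; rewrite coefM.
Qed.

Lemma dz_taylor F p n : holomorphic_at F p ->
  dz_rel p n (fun z => taylor F z n) (fun=> taylor (derive1 F) p n).
Proof.
move=> hF; rewrite /taylor derive1n_derive1; apply: dz_monom.
have := is_derive_scalel (n`!%:R)^-1 (holomorphic_is_derive (holomorphic_derive1n n hF)).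
rewrite mulrC (_ : (fun z => _) = (fun z => derive1n n F z / n`!%:R))//.
by apply/funext => z; rewrite mulrC.
Qed.

Lemma dz_taylor_hbar f p n : hol_seq f p ->
  dz_rel p n (fun z => taylor_hbar f z n) (fun=> taylor_hbar (fun k => derive1 (f k)) p n).
Proof.
move=> hf; pose T (g : nat -> C -> C) k z : {poly C} :=
  if (k.*2 <= n)%N then taylor (g k) z (n - k.*2)%N else 0.
rewrite (_ : (fun z => taylor_hbar f z n) = (fun z => \sum_(k < n.+1) T f k z)); last first.
  by apply/funext => z; rewrite /taylor_hbar big_mkcond.
rewrite (_ : (fun=> taylor_hbar _ p n) = (fun=> \sum_(k < n.+1) T (fun k => derive1 (f k)) k p)); last first.
  by rewrite /taylor_hbar big_mkcond.
apply: (@der_sum _ _ _ (dz_derivation p) n n.+1 (T f) (fun k _ => T (fun k => derive1 (f k)) k p)).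
move=> k _; rewrite /T; case: ifP => _; last exact: der_zero (dz_derivation p) n.
exact: (dz_taylor (n - k.*2) (hf k)).
Qed.

(** Differentiation of e^(-r^2 xi^2 / 2) under the integral sign brings down - r r' xi^2. *)
Lemma is_derive_FG_moment r p (r' : C) m : r p != 0 -> is_derive p (1 : C) r r' ->
  is_derive p (1 : C) (fun z => FG_moment (r z) m) (- (r p * r') * FG_moment (r p) m.+2).
Proof.
move=> r0 dr; have [om|em] := boolP (odd m).
  rewrite {2}/FG_moment /= negbK om mulr0 (_ : (fun z => _) = cst 0); last first.
    by apply/funext => z; rewrite /FG_moment om.
  exact: is_derive_cst.
have dV : is_derive p (1 : C) (fun z => (r z)^-1) (- (r p) ^- 2 * r').
  have [d1 d2] := dr; apply: DeriveDef; first exact: derivableV.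
  by rewrite deriveV// d2.
have := is_deriveX m.+1 dV.
move/(is_derive_scalel ((\prod_(i < m./2) i.*2.+1)%:R * sqrt2pi)).
rewrite (_ : (fun z => _) = (fun z => FG_moment (r z) m)); last first.
  by apply/funext => z; rewrite /FG_moment (negbTE em) exprfctE exprVn.
move=> H; apply: is_derive_eq H _.
apply: (mulfI (expf_neq0 2 r0)); rewrite [RHS]mulrCA FG_momentSS// /FG_moment (negbTE em).
by rewrite /GRing.scale /= exprVn -exprVn !exprVn !exprS; field; rewrite r0 expf_neq0.
Qed.

Lemma FG_XX c (P : {poly C}) N : (size P <= N)%N ->
  FG c ('X * ('X * P)) = \sum_(m < N) P`_m * FG_moment c m.+2.
Proof.
move=> PN; have szX (Q : {poly C}) M : (size Q <= M)%N -> (size ('X * Q)%R <= M.+1)%N.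
  move=> QM; apply: leq_trans (size_polyMleq _ _) _.
  by rewrite size_polyX /= add1n ltnS.
rewrite (FG_wide _ (szX _ _ (szX _ _ PN))) !big_ord_recl !coefXM /= !mul0r !add0r.
by apply: eq_bigr => i _; rewrite !coefXM.
Qed.

Lemma is_derive_FG r p (r' : C) n (P P' : C -> {poly C}) : r p != 0 ->
  is_derive p (1 : C) r r' -> dz_rel p n P P' ->
  is_derive p (1 : C) (fun z => FG (r z) (P z))
    (FG (r p) (P' p + (- (r p * r')) *: ('X * ('X * P p)))).
Proof.
move=> r0 dr [N [PN P'N dP]].
rewrite (_ : (fun z => _) = (fun z => \sum_(m < N) (P z)`_m * FG_moment (r z) m)); last first.
  by apply/funext => z; exact: FG_wide.
have d1 (m : 'I_N) := is_derive_mul (dP m) (is_derive_FG_moment m r0 dr).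
apply: is_derive_eq (is_derive_sum_ord d1) _.
rewrite big_split FG_add FG_scale (FG_wide _ (P'N p)); congr (_ + _).
rewrite (FG_XX _ (PN p)) mulr_sumr; apply: eq_bigr => i _; ring.
Qed.

Lemma derive1_mul F G q : holomorphic_at F q -> holomorphic_at G q ->
  derive1 (fun z => F z * G z) q = derive1 F q * G q + F q * derive1 G q.
Proof.
move=> hF hG; rewrite [LHS]derive1E.
by have [_ ->] := is_derive_mul (holomorphic_is_derive hF) (holomorphic_is_derive hG).
Qed.

Lemma derive1_scale c F q : holomorphic_at F q ->
  derive1 (fun z => c * F z) q = c * derive1 F q.
Proof.
move=> hF; rewrite [LHS]derive1E.
by have [_ ->] := is_derive_scalel c (holomorphic_is_derive hF).
Qed.

Lemma derive1_near F G q : (\forall z \near q, F z = G z) -> derive1 F q = derive1 G q.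
Proof. by move=> FG; exact: nbhs_singleton (near_eq_derive1n 1 FG). Qed.

Lemma derive1nZ n c F q : holomorphic_at F q ->
  derive1n n (fun z => c * F z) q = c * derive1n n F q.
Proof.
elim: n q => // n IH q hF.
have E : \forall z \near q, derive1n n (fun z => c * F z) z = c * derive1n n F z.
  by apply: filterS (holomorphic_near hF) => z; exact: IH.
by rewrite [LHS](derive1_near E) (derive1_scale c (holomorphic_derive1n n hF)).
Qed.

Lemma shS {V : zmodType} (P : nat -> V) n : sh P n.+1 = P n. Proof. by []. Qed.

Lemma ser_one0 : ser_one 0 = 1 :> {poly C}. Proof. by []. Qed.

Lemma ser_oneS n : ser_one n.+1 = 0 :> {poly C}. Proof. by []. Qed.

Lemma higher_phaseS Phi p n :
  higher_phase Phi p n.+1 = (derive1n n.+3 Phi p / n.+3`!%:R) *: 'X^(n.+3).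
Proof. by []. Qed.

Lemma taylor0 F p : taylor F p 0 = F p *: 1.
Proof. by rewrite /taylor /= invr1 mulr1. Qed.

(* The higher phase of A - y0 x, and its derivative along the saddle point,   *)
(* as functions of the jets a of A and X of x; with y(z) = y0, y'(z) = y1.    *)
Definition jet_phase (a X : nat -> C) (y0 : C) (n : nat) : {poly C} :=
  if n is m.+1 then ((a m.+3 - X m.+3 * y0) / m.+3`!%:R) *: 'X^(m.+3) else 0.

Definition jet_dz_phase (a X : nat -> C) (y0 y1 : C) (n : nat) : {poly C} :=
  if n is m.+1 then ((a n.+3 - X n.+3 * y0 - X n.+2 * y1) / n.+2`!%:R) *: 'X^(n.+2) else 0.

(** Chain rule for the exponent t^(-2) (Phi_z(w) - Phi_z(z)) with w = z + t xi: its z-derivative is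
    t^(-1) times its xi-derivative, minus t^(-2) y'(z) (x(w) - x(z)). The orders xi and xi^2 have to
    be checked separately, because there the Gaussian part intervenes. *)
Lemma sh2_jet_phase (a X : nat -> C) (y0 y1 y2 rr r2 : C) :
  a 3%N = y0 * X 3%N + 2 * (y1 * X 2%N) + y2 * X 1%N ->
  r2 = - (X 1%N * y1) -> rr = - (2^-1 * (X 2%N * y1 + X 1%N * y2)) ->
  sh (sh (jet_dz_phase a X y0 y1 + (- rr) *: mulX (mulX ser_one))) =
  sh (dxi (jet_phase a X y0) - r2 *: mulX ser_one) +
  (- y1) *: ((fun n => (X n / n`!%:R) *: 'X^n) - X 0%N *: ser_one).
Proof.
move=> a3 -> ->; apply/funext => -[|[|[|n]]]; rewrite [RHS]ser_addE ser_scaleE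
  [X in _ = _ + _ *: X]ser_addE [X in _ = _ + _ *: (_ + X)]ser_oppE ser_scaleE ?shS
  ?ser_addE ?ser_oppE ?ser_scaleE /mulX /dxi ?ser_oneS ?ser_one0 ?mulr0 ?scaler0 ?subr0 ?addr0.
- by rewrite /= fact0 divr1 expr0 subrr scaler0 addr0.
- rewrite /= derivC sub0r mulr1 expr1 divr1 scalerA -scaleNr -scalerDl.
  by rewrite (_ : _ + _ = 0) ?scale0r//; ring.
- rewrite [jet_dz_phase _ _ _ _ 0]/jet_dz_phase /jet_phase derivZ deriv_Xn mulr1 -expr2 add0r.
  rewrite !scalerA -scalerDl.
  congr (_ *: _); rewrite a3 (_ : 3`!%:R = 6 :> C)// (_ : 2`!%:R = 2 :> C)//.
  by field.
rewrite /jet_phase derivZ deriv_Xn !scalerA -scalerDl /jet_dz_phase; congr (_ *: _).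
have n0 : n.+4%:R != 0 :> C by rewrite pnatr_eq0.
have n1 : n.+3`!%:R != 0 :> C by rewrite pnatr_eq0 -lt0n fact_gt0.
rewrite [n.+4`!]factS natrM invfM mulrA mulrAC divfK// mulrA mulrAC.
ring.
Qed.

Lemma saddle_dz_algebra (Z E Q Q' : nat -> {poly C}) (c : C) n :
  (ser_mul (ser_mul Z E) Q + ser_mul E Q') n + c *: ('X * ('X * ser_mul E Q n)) =
  (ser_mul (Z + c *: mulX (mulX ser_one)) (ser_mul E Q) + ser_mul E Q') n.
Proof.
rewrite ser_mulDl ser_mulZl !mulX_mull ser_mul1 !ser_addE ser_scaleE /mulX ser_mulA.
by rewrite addrAC.
Qed.

Section MovingSaddle.
Context (x y A r : C -> C) (p : C).
Context (hx : holomorphic_at x p) (hy : holomorphic_at y p)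
  (hA : holomorphic_at A p) (hr : holomorphic_at r p).
Context (dA : \forall z \near p, derive1 A z = y z * derive1 x z).
Context (r2 : \forall z \near p, r z ^+ 2 = - (derive1 x z * derive1 y z)).
Context (r0 : r p != 0).

Definition phase_at z w := A w - x w * y z.

Lemma holomorphic_phase_at z q : holomorphic_at x q -> holomorphic_at A q ->
  holomorphic_at (phase_at z) q.
Proof.
move=> hxq hAq.
exact: (holomorphicB hAq (holomorphicM hxq (holomorphic_cst (y z) q))).
Qed.

Lemma derive1n_phase_at n z q : holomorphic_at x q -> holomorphic_at A q ->
  derive1n n (phase_at z) q = derive1n n A q - derive1n n x q * y z.
Proof.
move=> hxq hAq.
have hN : holomorphic_at (fun w => - y z * x w) q.
  exact: holomorphicM (holomorphic_cst (- y z) q) hxq.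
rewrite (_ : phase_at z = (fun w => A w + - y z * x w)); last first.
  by apply/funext => w; rewrite /phase_at mulNr mulrC.
by rewrite (derive1nD n hAq hN) (derive1nZ n (- y z) hxq) mulNr mulrC.
Qed.

Let hx1 := holomorphic_derive1 hx.
Let hy1 := holomorphic_derive1 hy.
Let hx2 := holomorphic_derive1 hx1.

Lemma derive1_A : derive1 A p = y p * derive1 x p.
Proof. exact: nbhs_singleton dA. Qed.

Lemma sqr_r : r p ^+ 2 = - (derive1 x p * derive1 y p).
Proof. exact: nbhs_singleton r2. Qed.

Lemma near_derive1n_A2 : \forall z \near p, derive1n 2 A z =
  derive1 y z * derive1 x z + y z * derive1n 2 x z.
Proof.
have := near_eq_derive1n 1 dA.
apply: filterS3 (holomorphic_near hx1) (holomorphic_near hy) => z hxz hyz Az.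
by rewrite [LHS]Az; exact (derive1_mul hyz hxz).
Qed.

Lemma derive1n_A3 : derive1n 3 A p = y p * derive1n 3 x p +
  2 * (derive1 y p * derive1n 2 x p) + derive1n 2 y p * derive1 x p.
Proof.
rewrite [LHS](derive1_near near_derive1n_A2).
have h1 := holomorphicM hy1 hx1; have h2 := holomorphicM hy hx2.
have alg (a b c d e f u v : C) : u = a * b + c * d -> v = c * d + e * f ->
    u + v = e * f + 2 * (c * d) + a * b by move=> -> ->; ring.
rewrite [LHS](derive1nD 1 h1 h2).
exact (alg _ _ _ _ _ _ _ _ (derive1_mul hy1 hx1) (derive1_mul hy hx2)).
Qed.

Lemma derive1_phase_at : derive1 (phase_at p) p = 0.
Proof.
rewrite -[LHS]/(derive1n 1 (phase_at p) p) (derive1n_phase_at 1 p hx hA).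
by rewrite -[derive1n 1 A p]/(derive1 A p) derive1_A mulrC subrr.
Qed.

Lemma derive1n_phase_at2 : derive1n 2 (phase_at p) p = - r p ^+ 2.
Proof.
have alg (a b c d u : C) : u = a * b + c * d -> u - d * c = - - (b * a).
  by move=> ->; ring.
rewrite (derive1n_phase_at 2 p hx hA) sqr_r.
exact (alg _ _ _ _ _ (nbhs_singleton near_derive1n_A2)).
Qed.

Lemma r_derive : r p * derive1 r p =
  - (2^-1 * (derive1n 2 x p * derive1 y p + derive1 x p * derive1n 2 y p)).
Proof.
have E : \forall z \near p, r z * r z = -1 * (derive1 x z * derive1 y z).
  by apply: filterS r2 => z; rewrite expr2 mulN1r.
have alg (a b u v : C) : u = b * a + a * b -> u = - 1 * v -> a * b = - (2^-1 * v).
  move=> -> H; have -> : v = - (b * a + a * b) by rewrite H mulN1r opprK.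
  by field.
apply: (alg _ _ _ _ (derive1_mul hr hr)); rewrite (derive1_near E).
rewrite (derive1_scale (-1) (holomorphicM hx1 hy1)).
by congr (_ * _); exact (derive1_mul hx1 hy1).
Qed.

Definition dz_phase : nat -> {poly C} :=
  jet_dz_phase (fun n => derive1n n A p) (fun n => derive1n n x p) (y p) (derive1 y p).

Lemma dz_higher_phase n :
  dz_rel p n (fun z => higher_phase (phase_at z) z n) (fun=> dz_phase n).
Proof.
case: n => [|n]; first exact: der_zero (dz_derivation p) 0%N.
rewrite /dz_phase; apply: dz_monom.
have d (F : C -> C) k : holomorphic_at F p ->
    is_derive p (1 : C) (derive1n k F) (derive1n k.+1 F p).
  by move=> hF; exact: (holomorphic_is_derive (holomorphic_derive1n k hF)).
have hyd := holomorphic_is_derive hy.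
have alg (k a b c e g : C) : k * (a + - 1 * (b * c + e * g)) = (a - b * c - e * g) * k by ring.
have alg' (k a b : C) : k * (a + - 1 * b) = (a - b) * k by ring.
have D := is_derive_scalel (n.+3`!%:R)^-1 (is_deriveD (d A n.+3 hA)
   (is_derive_scalel (- 1) (is_derive_mul (d x n.+3 hx) hyd))).
apply: (near_eq_is_derive _ (is_derive_eq D (alg _ _ _ _ _ _))).
apply: filterS2 (holomorphic_near hx) (holomorphic_near hA) => z hxz hAz.
by rewrite (derive1n_phase_at _ _ hxz hAz); exact (alg' _ _ _).
Qed.

Lemma sh2_dz_phase :
  sh (sh (dz_phase + (- (r p * derive1 r p)) *: mulX (mulX ser_one))) =
  sh (dxi (higher_phase (phase_at p) p) - r p ^+ 2 *: mulX ser_one) +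
  (- derive1 y p) *: (taylor x p - x p *: ser_one).
Proof.
have hE : higher_phase (phase_at p) p =
    jet_phase (fun n => derive1n n A p) (fun n => derive1n n x p) (y p).
  by apply/funext => -[//|n]; rewrite higher_phaseS (derive1n_phase_at n.+3 p hx hA).
rewrite hE.
exact (@sh2_jet_phase (fun n => derive1n n A p) (fun n => derive1n n x p)
  (y p) (derive1 y p) (derive1n 2 y p) _ _ derive1n_A3 sqr_r r_derive).
Qed.

(** Along w = z + t xi the z-derivative of the integrand is t^(-1) times a total xi-derivative,
    which integrates to 0, plus the explicit term - t^(-2) y'(z) (x(w) - x(z)). The derivative is
    named [V] because only t^2 [V] has a closed form. *)
Lemma saddle_dz f : hol_seq f p -> exists V : nat -> C,
  (forall n, is_derive p (1 : C)
    (fun z => saddle_series (r z) (phase_at z) z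
       (ser_mul (taylor_hbar f z) (taylor (derive1 x) z)) n) (V n)) /\
  sh (sh V) = (- derive1 y p) *: saddle_series (r p) (phase_at p) p
    (ser_mul (taylor x p - x p *: ser_one)
       (ser_mul (taylor_hbar f p) (taylor (derive1 x) p))).
Proof.
move=> hf; set h := higher_phase (phase_at p) p; set E := ser_exp h.
set Q := ser_mul (taylor_hbar f p) (taylor (derive1 x) p).
pose Q' : nat -> {poly C} := ser_mul (taylor_hbar (fun k => derive1 (f k)) p) (taylor (derive1 x) p) +
  ser_mul (taylor_hbar f p) (taylor (derive1 (derive1 x)) p).
pose W : nat -> {poly C} := dz_phase + (- (r p * derive1 r p)) *: mulX (mulX ser_one).
have dQ : dxi Q = sh Q'.
  by rewrite /Q dxi_mul dxi_taylor_hbar dxi_taylor ser_mul_shl ser_mul_shr -shD.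
exists (FG_int (r p) (ser_mul W (ser_mul E Q) + ser_mul E Q')); split.
  move=> n.
  have D1 : der_ser (dz_rel p) (fun z => ser_exp (higher_phase (phase_at z) z))
     (fun z => ser_mul dz_phase (ser_exp (higher_phase (phase_at z) z))).
    by apply: (der_ser_exp (dz_derivation p)) => //; exact: dz_higher_phase.
  have D2 : der_ser (dz_rel p)
      (fun z => ser_mul (taylor_hbar f z) (taylor (derive1 x) z))
      (fun z => ser_mul (taylor_hbar (fun k => derive1 (f k)) p) (taylor (derive1 x) z) +
         ser_mul (taylor_hbar f z) (taylor (derive1 (derive1 x)) p)).
    apply: (der_ser_mul (dz_derivation p)) => k; first exact: dz_taylor_hbar.
    exact: dz_taylor (holomorphic_derive1 hx).
  have D3 := der_ser_mul (dz_derivation p) D1 D2 n.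
  rewrite FG_intE -(saddle_dz_algebra dz_phase E Q Q' (- (r p * derive1 r p)) n).
  exact (is_derive_FG r0 (holomorphic_is_derive hr) D3).
have e1 : sh (sh (ser_mul W (ser_mul E Q))) = ser_mul (sh (sh W)) (ser_mul E Q).
  by rewrite !ser_mul_shl.
have e2 : sh (sh (ser_mul E Q')) = sh (ser_mul E (dxi Q)) by rewrite dQ ser_mul_shr.
pose G0 := dxi h - r p ^+ 2 *: mulX ser_one.
(* The integral of the total xi-derivative of the full integrand, Gaussian factor included. *)
have z : FG_int (r p) (ser_mul G0 (ser_mul E Q) + ser_mul E (dxi Q)) = 0.
  have := @FG_int_ibp _ (r p) h Q r0 (higher_phase0 _ _); rewrite -/E ser_mulDr FG_int_add.
  rewrite /G0 ser_mulDl -scaleNr ser_mulZl mulX_mull ser_mul1 !FG_int_add FG_int_scale.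
  rewrite -mulX_mulr (ser_mulA E) (ser_mulC E (dxi h)) -ser_mulA => H.
  by rewrite addrAC [X in X + _]addrC H scaleNr subrr.
have e3 : ser_mul (sh (sh W)) (ser_mul E Q) = sh (ser_mul G0 (ser_mul E Q)) +
    (- derive1 y p) *: ser_mul (taylor x p - x p *: ser_one) (ser_mul E Q).
  by rewrite sh2_dz_phase [LHS]ser_mulDl [in LHS]ser_mulZl [in LHS]ser_mul_shl.
rewrite -!FG_int_sh !shD e1 e2 e3 addrAC -shD FG_int_add FG_int_sh z FG_int_scale.
rewrite (_ : sh 0 = 0) ?add0r; last by apply/funext => -[].
by rewrite /saddle_series -/h -/E !ser_mulA (ser_mulC E).
Qed.

End MovingSaddle.

End SaddleDerivative.

(** * The Laplace transform of holomorphic amplitudes *)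

Section Transform.
Context {R : realType}.
Local Notation C := (Cplx R).
Implicit Types (F G u Phi x y A s : C -> C) (f g : nat -> C -> C) (p c z w : C) (n k : nat).

Local Opaque holomorphic_at derive1.

(* A stands for the primitive of y dx, up to a constant.                      *)
Definition sheet x y A s w : Prop :=
  [/\ holomorphic_at x w, holomorphic_at y w, holomorphic_at A w, holomorphic_at s w &
    \forall z \near w, [/\ derive1 A z = y z * derive1 x z,
      s z ^+ 2 = derive1 x z * derive1 y z & s z != 0]].

Lemma sheet_near x y A s w : sheet x y A s w -> \forall z \near w, sheet x y A s z.
Proof.
case=> hx hy hA hs H.
have H' := nbhs_interior H.
apply: filterS3 (filterI (holomorphic_near hx) (holomorphic_near hy))
  (filterI (holomorphic_near hA) (holomorphic_near hs)) H' => z [? ?] [? ?] Hz.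
by split.
Qed.

Lemma sqr_Ni (a : C) : (- 'i * a) ^+ 2 = - a ^+ 2.
Proof. by rewrite exprMn sqrrN sqrCi mulN1r. Qed.

Lemma derive1_opp F q : holomorphic_at F q -> derive1 (fun z => - F z) q = - derive1 F q.
Proof.
move=> hF; have := derive1_scale (- 1) hF.
rewrite (_ : (fun z => -1 * F z) = (fun z => - F z)).
  by move=> ->; exact (mulN1r _).
by apply/funext => z; rewrite mulN1r.
Qed.

Lemma derive1_sub F G q : holomorphic_at F q -> holomorphic_at G q ->
  derive1 (fun z => F z - G z) q = derive1 F q - derive1 G q.
Proof.
move=> hF hG; rewrite [LHS]derive1E.
have [_ H] := is_deriveB (holomorphic_is_derive hF) (holomorphic_is_derive hG).
exact H.
Qed.

(** The Legendre transform A - x y is a primitive of - x dy. The root - i s is the one for which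
    multiplication by i returns s, the root used in [Laplace_inv]. *)
Lemma sheet_dual x y A s w : sheet x y A s w ->
  sheet y (fun z => - x z) (fun z => A z - x z * y z) (fun z => - 'i * s z) w.
Proof.
move=> sh; have shz := sheet_near sh; case: sh => hx hy hA hs H; split.
- exact: hy.
- exact: (holomorphicN hx).
- exact: (holomorphicB hA (holomorphicM hx hy)).
- exact: (holomorphicM (holomorphic_cst (- 'i) w) hs).
apply: filterS2 H shz => z [dA s2 s0] [hxz hyz hAz _ _]; split.
- rewrite (derive1_sub hAz (holomorphicM hxz hyz)) (derive1_mul hxz hyz) dA.
  have alg (a b c d : C) : b * a - (a * b + c * d) = - c * d by ring.
  exact (alg _ _ _ _).
- rewrite sqr_Ni s2 (derive1_opp hxz).
  have alg (a b : C) : - (a * b) = b * - a by ring.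
  exact (alg _ _).
by rewrite mulf_neq0// oppr_eq0 neq0Ci.
Qed.

Definition saddle_op x y A s f z : nat -> C :=
  saddle_series ('i * s z) (phase_at x y A z) z
    (ser_mul (taylor_hbar f z) (taylor (derive1 x) z)).

(* The amplitudes of the Laplace transform, without the factor (2 pi)^(-1/2). *)
Definition trans x y A s f k z : C := saddle_op x y A s f z k.*2.

Lemma taylor_hbar_near f g p : (\forall z \near p, forall k, f k z = g k z) ->
  taylor_hbar f p = taylor_hbar g p.
Proof.
move=> fg; apply/funext => n; rewrite /taylor_hbar; apply: eq_bigr => k _.
by rewrite (@taylor_near _ (f k) (g k))//; apply: filterS fg => z; apply.
Qed.

Lemma saddle_op_near x y A s f g p : (\forall z \near p, forall k, f k z = g k z) ->
  saddle_op x y A s f p = saddle_op x y A s g p.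
Proof. by move=> /taylor_hbar_near fg; rewrite /saddle_op fg. Qed.

Lemma saddle_opD x y A s f g p : hol_seq f p -> hol_seq g p ->
  saddle_op x y A s (fun k z => f k z + g k z) p =
  saddle_op x y A s f p + saddle_op x y A s g p.
Proof.
move=> hf hg; rewrite /saddle_op taylor_hbarD// ser_mulDl.
exact: saddle_seriesD.
Qed.

Lemma hol_seqM F f p : holomorphic_at F p -> hol_seq f p ->
  hol_seq (fun k z => F z * f k z) p.
Proof. by move=> hF hf k; exact: (holomorphicM hF (hf k)). Qed.

Lemma hol_seqD f g p : hol_seq f p -> hol_seq g p -> hol_seq (fun k z => f k z + g k z) p.
Proof. by move=> hf hg k; exact: (holomorphicD (hf k) (hg k)). Qed.

Lemma hol_seq_hshift f p : hol_seq f p -> hol_seq (hshift f) p.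
Proof. by move=> hf [|k]; [exact: holomorphic_cst|exact: hf]. Qed.

Lemma saddle_opZ x y A s c f p : hol_seq f p ->
  saddle_op x y A s (fun k z => c * f k z) p = c *: saddle_op x y A s f p.
Proof.
move=> hf; rewrite /saddle_op (taylor_hbarM (holomorphic_cst c p) hf) taylor_cst.
by rewrite ser_mulZl ser_mul1 ser_mulZl saddle_seriesZ.
Qed.

Lemma saddle_op_hshift x y A s f p :
  saddle_op x y A s (hshift f) p = sh (sh (saddle_op x y A s f p)).
Proof. by rewrite /saddle_op taylor_hbar_hshift !ser_mul_shl !saddle_series_sh. Qed.

Section AtPoint.
Context (x y A s : C -> C) (p : C).
Context (shp : sheet x y A s p).

Let hx : holomorphic_at x p. Proof. by case: shp. Qed.
Let hy : holomorphic_at y p. Proof. by case: shp. Qed.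
Let hA : holomorphic_at A p. Proof. by case: shp. Qed.
Let hs : holomorphic_at s p. Proof. by case: shp. Qed.
Let hr : holomorphic_at (fun z => 'i * s z) p.
Proof. exact: (holomorphicM (holomorphic_cst 'i p) hs). Qed.
Let dA : \forall z \near p, derive1 A z = y z * derive1 x z.
Proof. by case: shp => _ _ _ _; apply: filterS => z []. Qed.
Let r2 : \forall z \near p, ('i * s z) ^+ 2 = - (derive1 x z * derive1 y z).
Proof.
case: shp => _ _ _ _; apply: filterS => z [_ s2 _].
by rewrite exprMn sqrCi s2; exact (mulN1r _).
Qed.
Let r0 : 'i * s p != 0.
Proof.
case: shp => _ _ _ _ /nbhs_singleton [_ _ s0].
by rewrite mulf_neq0// neq0Ci.
Qed.
Let dx0 : \forall z \near p, derive1 x z != 0.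
Proof.
case: shp => _ _ _ _; apply: filterS => z [_ s2 s0].
have alg (a b c : C) : c ^+ 2 = a * b -> c != 0 -> a != 0.
  move=> cab; apply: contraNneq => a0; move: cab; rewrite a0 mul0r => /eqP.
  by rewrite expf_eq0.
exact (alg _ _ _ s2 s0).
Qed.

Let P1 := derive1_phase_at hx hA dA.
Let P2 := derive1n_phase_at2 hx hy hA dA r2.

Lemma holomorphic_divx F : holomorphic_at F p ->
  holomorphic_at (fun z => F z / derive1 x z) p.
Proof.
move=> hF; apply: (holomorphicM hF); apply: holomorphicV.
  exact: holomorphic_derive1.
exact: nbhs_singleton dx0.
Qed.

(** Here Phi' = (y - y(p)) x', so the measure factor x' splits off both from Phi' f and from f' =
    (f'/x') x'. *)
Lemma saddle_op_ibp f : hol_seq f p ->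
  sh (sh (saddle_op x y A s (fun k z => derive1 (f k) z / derive1 x z) p)) =
  - saddle_op x y A s (fun k z => (y z - y p) * f k z) p.
Proof.
move=> hf; have hx' := holomorphic_derive1 hx.
have hy' : holomorphic_at (fun z => y z - y p) p.
  exact: (holomorphicB hy (holomorphic_cst _ _)).
have E1 : taylor (derive1 (phase_at x y A p)) p =
    ser_mul (taylor (fun z => y z - y p) p) (taylor (derive1 x) p).
  rewrite -(taylorM hy' hx'); apply: taylor_near.
  apply: filterS3 dA (holomorphic_near hx) (holomorphic_near hA) => z Az hxz hAz.
  rewrite -[derive1 (phase_at x y A p) z]/(derive1n 1 _ z) (derive1n_phase_at y 1 p hxz hAz).
  rewrite -[derive1n 1 A z]/(derive1 A z) Az.
  have alg (a b c : C) : b * a - a * c = (b - c) * a by ring.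
  exact (alg _ _ _).
have hq : hol_seq (fun k z => derive1 (f k) z / derive1 x z) p.
  by move=> k; exact: (holomorphic_divx (holomorphic_derive1 (hf k))).
have E2 : taylor_hbar (fun k => derive1 (f k)) p =
    ser_mul (taylor_hbar (fun k z => derive1 (f k) z / derive1 x z) p) (taylor (derive1 x) p).
  rewrite ser_mulC -(taylor_hbarM hx' hq); apply: taylor_hbar_near.
  apply: filterS dx0 => z xz k.
  have alg (a b : C) : a != 0 -> b = a * (b / a) by move=> a0; rewrite mulrC divfK.
  exact (alg _ _ xz).
have E3 := taylor_hbarM hy' hf.
rewrite /saddle_op (saddle_ibp r0 P1 P2 E1 E2) E3.
by rewrite -!ser_mulA (ser_mulC (taylor (derive1 x) p)).
Qed.

Lemma saddle_op_euler f : hol_seq f p ->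
  sh (sh (fun n => n.+1%:R * saddle_op x y A s f p n)) =
  (- 2) *: saddle_op x y A s
    (fun k z => (phase_at x y A p z - phase_at x y A p p) * f k z) p +
  2 *: sh (sh (saddle_op x y A s (fun k z => k%:R * f k z) p)).
Proof.
move=> hf; have := saddle_euler (derive1 x) r0 P1 P2 hf; rewrite /saddle_op => ->.
have hP := holomorphic_phase_at y p hx hA.
have hPc : holomorphic_at (fun z => phase_at x y A p z - phase_at x y A p p) p.
  exact: (holomorphicB hP (holomorphic_cst _ _)).
rewrite (taylor_hbarM hPc hf).
rewrite (taylorD hP (holomorphicN (holomorphic_cst (phase_at x y A p p) p))).
have -> : taylor (fun=> - phase_at x y A p p) p = - (phase_at x y A p p *: ser_one).
  by rewrite taylor_cst scaleNr.
by rewrite ser_mulA.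
Qed.

Lemma saddle_op_dz f : hol_seq f p ->
  exists V : nat -> C,
  (forall n, is_derive p (1 : C) (fun z => saddle_op x y A s f z n) (V n)) /\
  sh (sh V) = (- derive1 y p) *: saddle_op x y A s (fun k z => (x z - x p) * f k z) p.
Proof.
move=> hf; have [V [dV sV]] := saddle_dz hx hy hA hr dA r2 r0 hf.
exists V; split; first exact: dV.
rewrite sV /saddle_op.
have hxc : holomorphic_at (fun z => x z - x p) p.
  exact: (holomorphicB hx (holomorphic_cst _ _)).
rewrite (taylor_hbarM hxc hf) (taylorD hx (holomorphicN (holomorphic_cst (x p) p))).
have -> : taylor (fun=> - x p) p = - (x p *: ser_one) by rewrite taylor_cst scaleNr.
by rewrite ser_mulA.
Qed.

Lemma ser_exp0 (h : nat -> {poly C}) : ser_exp h 0 = 1.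
Proof. by rewrite /ser_exp big_ord1 /= invr1 scale1r. Qed.

Lemma saddle_op0 f :
  saddle_op x y A s f p 0 = f 0%N p * derive1 x p * (sqrt2pi / ('i * s p)).
Proof.
rewrite /saddle_op /saddle_series FG_intE /ser_mul !big_ord1 ser_exp0 mul1r !taylor0.
rewrite /taylor_hbar big_mkcond big_ord1 /= taylor0 -scalerAl -scalerAr scalerA mulr1.
by rewrite FG_scale -(expr0 'X) FG_Xn /FG_moment /= big_ord0 mul1r expr1.
Qed.

Lemma transD f g k : hol_seq f p -> hol_seq g p ->
  trans x y A s (fun k z => f k z + g k z) k p = trans x y A s f k p + trans x y A s g k p.
Proof. by move=> hf hg; rewrite /trans saddle_opD. Qed.

Lemma transZ c f k : hol_seq f p ->
  trans x y A s (fun k z => c * f k z) k p = c * trans x y A s f k p.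
Proof. by move=> hf; rewrite /trans saddle_opZ. Qed.

Lemma trans_hshift f k :
  trans x y A s (hshift f) k p = sh (fun k => trans x y A s f k p) k.
Proof. by rewrite /trans saddle_op_hshift; case: k. Qed.

Lemma trans_sub F f k : holomorphic_at F p -> hol_seq f p ->
  trans x y A s (fun k z => (F z - F p) * f k z) k p =
  trans x y A s (fun k z => F z * f k z) k p - F p * trans x y A s f k p.
Proof.
move=> hF hf.
rewrite (_ : (fun k z => _) = (fun k z => F z * f k z + - F p * f k z)); last first.
  by apply/funext => i; apply/funext => z; rewrite mulrBl mulNr.
by rewrite (transD k (hol_seqM hF hf) (hol_seqM (holomorphic_cst (- F p) p) hf))
  (transZ (- F p) k hf) mulNr.
Qed.

(** With e^(A/hbar) stripped off, hbar d/dx acts on amplitudes as y + hbar d/dx; the transform turns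
    it into multiplication by y(p). *)
Lemma trans_ibp f k : hol_seq f p ->
  y p * trans x y A s f k p = trans x y A s (fun k z => y z * f k z) k p +
    sh (fun k => trans x y A s (fun k z => derive1 (f k) z / derive1 x z) k p) k.
Proof.
move=> hf; have := congr1 (@^~ k.*2) (saddle_op_ibp hf).
have -> : sh (sh (saddle_op x y A s (fun k z => derive1 (f k) z / derive1 x z) p)) k.*2 =
  sh (fun k => trans x y A s (fun k z => derive1 (f k) z / derive1 x z) k p) k by case: k.
rewrite ser_oppE -[X in - X]/(trans _ _ _ _ _ k p) (trans_sub k hy hf) => ->.
by rewrite opprB addrC subrK.
Qed.

(** The factor 2k + 1 is t d/dt + 1 at t^(2k); the unit comes from integrating xi d/dxi by parts. *)
Lemma trans_euler f k : hol_seq f p ->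
  sh (fun k => k.*2.+1%:R * trans x y A s f k p) k =
  - 2 * (trans x y A s (fun k z => A z * f k z) k p
     - y p * trans x y A s (fun k z => x z * f k z) k p
     + (x p * y p - A p) * trans x y A s f k p) +
  2 * sh (fun k => trans x y A s (fun k z => k%:R * f k z) k p) k.
Proof.
move=> hf; have := congr1 (@^~ k.*2) (saddle_op_euler hf).
have hP := holomorphic_phase_at y p hx hA.
rewrite ser_addE !ser_scaleE -[X in - 2 *: X]/(trans _ _ _ _ _ k p) (trans_sub k hP hf).
have -> : sh (sh (fun n => n.+1%:R * saddle_op x y A s f p n)) k.*2 =
  sh (fun k => k.*2.+1%:R * trans x y A s f k p) k by case: k.
have -> : sh (sh (saddle_op x y A s (fun k z => k%:R * f k z) p)) k.*2 =
  sh (fun k => trans x y A s (fun k z => k%:R * f k z) k p) k by case: k.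
move=> ->; rewrite /GRing.scale /=; congr (_ * _ + _).
rewrite (_ : (fun k z => phase_at x y A p z * f k z) =
   (fun k z => A z * f k z + - y p * (x z * f k z))); last first.
  by apply/funext => i; apply/funext => z; rewrite /phase_at; ring.
have hxf := hol_seqM hx hf.
rewrite (transD k (hol_seqM hA hf) (hol_seqM (holomorphic_cst (- y p) p) hxf)).
by rewrite (transZ (- y p) k hxf) /phase_at; ring.
Qed.

(** With e^((A - x y)/hbar) stripped off, - hbar d/dy acts as x - hbar d/dy; this is what
    multiplication by x becomes. *)
Lemma trans_dz f k : hol_seq f p ->
  sh (fun k => derive1 (trans x y A s f k) p) k = - derive1 y p *
    (trans x y A s (fun k z => x z * f k z) k p - x p * trans x y A s f k p).
Proof.
move=> hf; have [V [dV sV]] := saddle_op_dz hf.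
have dV' i : derive1 (trans x y A s f i) p = V i.*2.
  by rewrite [LHS]derive1E; have [_ ->] := dV i.*2.
have H : sh (sh V) k.*2 = - derive1 y p * trans x y A s (fun k z => (x z - x p) * f k z) k p.
  exact (congr1 (@^~ k.*2) sV).
rewrite -(trans_sub k hx hf) -H.
by case: k {H} => //= k; rewrite dV'.
Qed.

End AtPoint.

End Transform.

(** * Composition with the dual transform *)

Section Inversion.
Context {R : realType}.
Local Notation C := (Cplx R).
Implicit Types (F G u Phi x y A s : C -> C) (f g : nat -> C -> C) (p c z w : C) (n k : nat).

Local Opaque holomorphic_at derive1.

(** Allows holomorphy and meromorphy of the transform to be proved by one argument. *)
Record function_class p (K : (C -> C) -> Prop) : Prop := {
  fc_cst : forall c, K (fun=> c);
  fc_add : forall F G, K F -> K G -> K (fun z => F z + G z);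
  fc_mul : forall F G, K F -> K G -> K (fun z => F z * G z);
  fc_ext : forall F G, (\forall z \near p, F z = G z) -> K F -> K G }.

Lemma holomorphic_class p : function_class p (fun F => holomorphic_at F p).
Proof.
split=> [c|F G|F G|F G].
- exact: holomorphic_cst.
- exact: holomorphicD.
- exact: holomorphicM.
- exact: holomorphic_ext.
Qed.

Lemma meromorphic_class p : function_class p (fun F => meromorphic_at F p).
Proof.
split=> [c|F G|F G|F G FG [n hF]].
- exact (holomorphic_meromorphic (holomorphic_cst c p)).
- exact: meromorphicD.
- exact: meromorphicM.
exists n; apply: holomorphic_ext hF.
by apply: filterS FG => z ->.
Qed.

Section ClassClosure.
Context (p : C) (K : (C -> C) -> Prop) (HK : function_class p K).

Lemma fc_sum N (F : nat -> C -> C) : (forall i, (i < N)%N -> K (F i)) ->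
  K (fun z => \sum_(i < N) F i z).
Proof.
elim: N => [|N IH] H.
  rewrite (_ : (fun z => _) = fun=> 0); first exact: (fc_cst HK).
  by apply/funext => z; rewrite big_ord0.
rewrite (_ : (fun z => _) = (fun z => \sum_(i < N) F i z + F N z)).
  apply: (fc_add HK); last exact: H.
  by apply: IH => i iN; apply: H; exact: ltnW.
by apply/funext => z; rewrite big_ord_recr.
Qed.

Lemma fc_exp n F : K F -> K (fun z => F z ^+ n).
Proof.
move=> KF; elim: n => [|n IH].
  by rewrite (_ : (fun z => _) = fun=> 1); [exact: (fc_cst HK)|apply/funext => z; rewrite expr0].
rewrite (_ : (fun z => _) = (fun z => F z * F z ^+ n)); first exact: (fc_mul HK KF IH).
by apply/funext => z; rewrite exprS.
Qed.

Lemma fc_scale c F : K F -> K (fun z => c * F z).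
Proof. exact: (fc_mul HK (fc_cst HK c)). Qed.

Definition class_rel (n : nat) (P P' : C -> {poly C}) : Prop :=
  exists N, (forall z, (size (P z) <= N)%N) /\ (forall m, K (fun z => (P z)`_m)).

Lemma class_monom n k (a : C -> C) P' : K a -> class_rel n (fun z => a z *: 'X^k) P'.
Proof.
move=> Ka; exists k.+1; split=> [z|m].
  by rewrite (leq_trans (size_scale_leq _ _))// size_polyXn.
rewrite (_ : (fun z => _) = (fun z => ('X^k : {poly C})`_m * a z)).
  exact: fc_scale.
by apply/funext => z; rewrite coefZ mulrC.
Qed.

Lemma class_derivation : derivation_rel class_rel.
Proof.
split.
- have := @class_monom 0 0 (fun=> 1) (fun=> 0) (fc_cst HK 1).
  by rewrite (_ : (fun z => _) = fun=> 1)//; apply/funext => z; rewrite scale1r.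
- move=> n; have := @class_monom n 0 (fun=> 0) (fun=> 0) (fc_cst HK 0).
  by rewrite (_ : (fun z => _) = fun=> 0)//; apply/funext => z; rewrite scale0r.
- move=> n P P' Q Q' [N [PN KP]] [M [QM KQ]]; exists (maxn N M); split=> [z|m].
    apply: leq_trans (size_polyD _ _) _.
    by rewrite geq_max !leq_max PN QM orbT.
  rewrite (_ : (fun z => _) = (fun z => (P z)`_m + (Q z)`_m)).
    exact: (fc_add HK (KP m) (KQ m)).
  by apply/funext => z; rewrite coefD.
- move=> n c P P' [N [PN KP]]; exists N; split=> [z|m].
    by rewrite (leq_trans (size_scale_leq _ _)).
  rewrite (_ : (fun z => _) = (fun z => c * (P z)`_m)); first exact: fc_scale (KP m).
  by apply/funext => z; rewrite coefZ.
move=> n k P P' Q Q' [N [PN KP]] [M [QM KQ]]; exists (N + M)%N; split=> [z|m].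
  apply: leq_trans (size_polyMleq _ _) _.
  by rewrite (leq_trans (leq_pred _))// leq_add.
rewrite (_ : (fun z => _) = (fun z => \sum_(i < m.+1) (P z)`_i * (Q z)`_(m - i))).
  apply: (@fc_sum m.+1 (fun i z => (P z)`_i * (Q z)`_(m - i))) => i _.
  exact: (fc_mul HK (KP i) (KQ (m - i)%N)).
by apply/funext => z; rewrite coefM.
Qed.

Lemma class_taylor F n P' : (forall m, K (derive1n m F)) -> class_rel n (fun z => taylor F z n) P'.
Proof.
move=> KF; apply: class_monom.
rewrite (_ : (fun z => _) = (fun z => (n`!%:R)^-1 * derive1n n F z)).
  exact: fc_scale (KF n).
by apply/funext => z; rewrite mulrC.
Qed.

Lemma class_taylor_hbar f n P' : (forall k m, K (derive1n m (f k))) ->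
  class_rel n (fun z => taylor_hbar f z n) P'.
Proof.
move=> Kf; pose T k z : {poly C} :=
  if (k.*2 <= n)%N then taylor (f k) z (n - k.*2)%N else 0.
rewrite (_ : (fun z => _) = (fun z => \sum_(k < n.+1) T k z)); last first.
  by apply/funext => z; rewrite /taylor_hbar big_mkcond.
have H : class_rel n (fun z => \sum_(k < n.+1) T k z) (fun=> \sum_(k < n.+1) 0).
  apply: (@der_sum _ _ _ class_derivation n n.+1 T (fun _ _ => 0)) => k _.
  rewrite /T; case: (k.*2 <= n)%N; last exact: (der_zero class_derivation n).
  exact: (class_taylor (n - k.*2) (fun=> 0) (Kf k)).
exact H.
Qed.

(** Each coefficient of the transform is a polynomial in y, 1/s and finitely many derivatives of x,
    A and the amplitudes. *)
Lemma class_trans x y A s f k : holomorphic_at x p -> holomorphic_at A p ->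
  K y -> (forall n, K (derive1n n x)) -> (forall n, K (derive1n n A)) ->
  (forall k n, K (derive1n n (f k))) -> K (fun z => (s z)^-1) -> K (trans x y A s f k).
Proof.
move=> hx hA Ky Kx KA Kf Ks.
(* The zero families are dummies: [class_rel] only constrains the first family. *)
have D1 : der_ser class_rel (fun z => higher_phase (phase_at x y A z) z) (fun _ _ => 0).
  case=> [|n]; first exact: der_zero class_derivation 0%N.
  apply: class_monom; apply: (fc_ext HK) (fc_scale (n.+3`!%:R)^-1
    (fc_add HK (KA n.+3) (fc_scale (- 1) (fc_mul HK (Kx n.+3) Ky)))).
  apply: filterS2 (holomorphic_near hx) (holomorphic_near hA) => z hxz hAz.
  rewrite (derive1n_phase_at y n.+3 z hxz hAz).
  have alg (a b c : C) : c * (a + - 1 * b) = (a - b) * c by ring.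
  exact (alg _ _ _).
have D2 := @der_ser_exp _ _ _ class_derivation _ _ D1 (fun=> erefl) (fun=> erefl).
have D3 : der_ser class_rel (taylor_hbar f) (fun _ _ => 0).
  by move=> n; exact: class_taylor_hbar.
have D4 : der_ser class_rel (taylor (derive1 x)) (fun _ _ => 0).
  by move=> n; apply: class_taylor => m; rewrite derive1n_derive1.
have [N [PN KP]] := der_ser_mul class_derivation D2 (der_ser_mul class_derivation D3 D4) k.*2.
have -> : trans x y A s f k = fun z => \sum_(m < N)
   (ser_mul (ser_exp (higher_phase (phase_at x y A z) z))
      (ser_mul (taylor_hbar f z) (taylor (derive1 x) z)) k.*2)`_m * FG_moment ('i * s z) m.
  by apply/funext => z; exact: (FG_wide _ (PN z)).
apply: (@fc_sum N (fun m z => (ser_mul (ser_exp (higher_phase (phase_at x y A z) z))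
      (ser_mul (taylor_hbar f z) (taylor (derive1 x) z)) k.*2)`_m * FG_moment ('i * s z) m)) => m _.
apply: (fc_mul HK (KP m)); rewrite /FG_moment; case: odd; first exact: (fc_cst HK).
have := fc_scale ((\prod_(i < m./2) i.*2.+1)%:R * sqrt2pi) (fc_exp m.+1 (fc_scale 'i^-1 Ks)).
by congr K; apply/funext => z; rewrite -invfM exprVn.
Qed.

End ClassClosure.

Lemma hol_seq_trans x y A s f p : sheet x y A s p -> hol_seq f p ->
  hol_seq (trans x y A s f) p.
Proof.
move=> [hx hy hA hs H] hf k.
apply: (class_trans (holomorphic_class p) k hx hA hy).
- by move=> n; exact: (holomorphic_derive1n n hx).
- by move=> n; exact: (holomorphic_derive1n n hA).
- by move=> j n; exact: (holomorphic_derive1n n (hf j)).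
apply: (holomorphicV hs).
by have [_ _ ->] := nbhs_singleton H.
Qed.

Lemma trans_near x y A s f g k p : (\forall z \near p, forall k, f k z = g k z) ->
  trans x y A s f k p = trans x y A s g k p.
Proof. by move=> /(@saddle_op_near _ x y A s) fg; rewrite /trans fg. Qed.

Lemma trans_hshift_fun x y A s f : trans x y A s (hshift f) = hshift (trans x y A s f).
Proof. by apply/funext => k; apply/funext => z; rewrite trans_hshift; case: k. Qed.

Lemma trans0 x y A s k p : trans x y A s (fun _ _ => 0) k p = 0.
Proof.
have h0 : hol_seq (fun _ _ => 0) p by move=> i; exact: holomorphic_cst.
have := transZ x y A s 0 k h0.
by rewrite !mul0r.
Qed.

Lemma sheet_dx0 x y A s p : sheet x y A s p -> derive1 x p != 0 /\ derive1 y p != 0.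
Proof.
case=> _ _ _ _ /nbhs_singleton [_ s2 s0].
have alg (a b c : C) : c ^+ 2 = a * b -> c != 0 -> a != 0 /\ b != 0.
  move=> cab c0; have : a * b != 0 by rewrite -cab expf_neq0.
  by rewrite mulf_eq0 negb_or => /andP.
exact (alg _ _ _ s2 s0).
Qed.

(* The inverse transform is, up to a constant, the transform of the dual      *)
(* sheet (y, -x), whose square root of - x'y' is - 'i s.                      *)
Definition trans_dual x y A s := trans y (fun z => - x z) (fun z => A z - x z * y z)
  (fun z => - 'i * s z).

Definition seq0 F k : C -> C := if k == 0%N then F else fun=> 0.

Section Composition.
Context (x y A s : C -> C) (w : C).
Context (shw : sheet x y A s w).

Local Notation L := (trans x y A s).
Local Notation M := (trans_dual x y A s).

(** One neighbourhood for all k: the relations for [L] are substituted inside [M] by [trans_near],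
    which asks for them at every nearby point and for all k at once. *)
Definition uniform f : Prop := \forall z \near w, hol_seq f z.

Let shd := sheet_dual shw.
Let hx : holomorphic_at x w. Proof. by case: shw. Qed.
Let hy : holomorphic_at y w. Proof. by case: shw. Qed.
Let hA : holomorphic_at A w. Proof. by case: shw. Qed.

Lemma uniform_hol f : uniform f -> hol_seq f w.
Proof. exact: nbhs_singleton. Qed.

Lemma uniformM F f : holomorphic_at F w -> uniform f -> uniform (fun k z => F z * f k z).
Proof.
move=> hF uf; apply: filterS2 (holomorphic_near hF) uf => z; exact: hol_seqM.
Qed.

Lemma uniform_trans f : uniform f -> uniform (L f).
Proof. by apply: filterS2 (sheet_near shw) => z; exact: hol_seq_trans. Qed.

Lemma uniform_divx f : uniform f -> uniform (fun k z => derive1 (f k) z / derive1 x z).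
Proof.
apply: filterS2 (sheet_near shw) => z shz hf k.
exact: (holomorphic_divx shz (holomorphic_derive1 (hf k))).
Qed.

Lemma comp_D f g k : uniform f -> uniform g ->
  M (L (fun k z => f k z + g k z)) k w = M (L f) k w + M (L g) k w.
Proof.
move=> uf ug; rewrite /trans_dual.
rewrite -(transD _ _ _ _ k (uniform_hol (uniform_trans uf)) (uniform_hol (uniform_trans ug))).
by apply: trans_near; apply: filterS2 uf ug => z fz gz i; exact: transD.
Qed.

Lemma comp_Z c f k : uniform f ->
  M (L (fun k z => c * f k z)) k w = c * M (L f) k w.
Proof.
move=> uf; rewrite /trans_dual -(transZ _ _ _ _ c k (uniform_hol (uniform_trans uf))).
by apply: trans_near; apply: filterS uf => z fz i; exact: transZ.
Qed.

Lemma comp_hshift f k : M (L (hshift f)) k w = sh (fun k => M (L f) k w) k.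
Proof. by rewrite /trans_dual trans_hshift_fun trans_hshift. Qed.

Lemma comp_near f g k : (\forall z \near w, forall k, f k z = g k z) ->
  M (L f) k w = M (L g) k w.
Proof.
move=> /nbhs_interior fg; apply: trans_near; apply: filterS fg => z fgz i.
exact: trans_near.
Qed.

(** Moving x out of [L] costs hbar (L f)' / y'. Moving it out of [M], where x is minus the second
    coordinate of the dual sheet, costs the same term with the opposite sign, and the two cancel. *)
Lemma comp_mulx f k : uniform f -> M (L (fun k z => x z * f k z)) k w = x w * M (L f) k w.
Proof.
move=> uf; have uLf := uniform_trans uf; have hLf := uniform_hol uLf.
have uxf := uniformM hx uf.
pose q : nat -> C -> C := fun k z => derive1 (L f k) z / derive1 y z.
have hq : hol_seq q w.
  by move=> i; exact: (holomorphic_divx shd (holomorphic_derive1 (hLf i))).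
have E : \forall z \near w, forall k, x z * L f k z = L (fun k z => x z * f k z) k z + hshift q k z.
  apply: filterS2 (sheet_near shw) uf => z shz fz i.
  have [_ y0] := sheet_dx0 shz.
  have alg (a b c d e : C) : c != 0 -> e = - c * (b - a) -> d = e / c -> a = b + d.
    by move=> c0 -> ->; field.
  apply: (alg _ _ _ _ _ y0 (trans_dz shz i fz)).
  by case: i => [|i] /=; [rewrite mul0r|].
have H1 : M (fun k z => x z * L f k z) k w =
    M (L (fun k z => x z * f k z)) k w + sh (fun k => M q k w) k.
  rewrite -[sh _ k](trans_hshift y (fun z => - x z) (fun z => A z - x z * y z) (fun z => - 'i * s z) w q k).
  rewrite -(transD _ _ _ _ k (uniform_hol (uniform_trans uxf)) (hol_seq_hshift hq)).
  exact: trans_near E.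
have H2 := trans_ibp shd k hLf.
have H3 : trans y (fun z => - x z) (fun z => A z - x z * y z) (fun z => - 'i * s z)
    (fun k z => - x z * L f k z) k w = - 1 * M (fun k z => x z * L f k z) k w.
  rewrite -(transZ _ _ _ _ (- 1) k (hol_seqM hx hLf)); congr trans.
  by apply/funext => i; apply/funext => z; rewrite mulrA mulN1r.
rewrite H3 in H2.
have alg (a b c d e : C) : e = a + c -> - d * b = - 1 * e + c -> a = d * b.
  move=> ->; rewrite mulN1r opprD addrNK mulNr => /eqP; rewrite eqr_opp => /eqP ->//.
exact (alg _ _ _ _ _ H1 H2).
Qed.

Lemma divide_x F : holomorphic_at F w ->
  exists2 q, holomorphic_at q w & \forall z \near w, F z = F w + (x z - x w) * q z.
Proof.
move=> hF.
have fac G : holomorphic_at G w -> exists2 a, holomorphic_at a w &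
    forall z, G z - G w = (z - w) * a z.
  move=> hG; apply: holomorphic_factor; last exact: subrr.
  exact: (holomorphicB hG (holomorphic_cst _ _)).
have [a ha aE] := fac F hF; have [b hb bE] := fac x hx.
(* The derivative of (z - w) b at w is b(w), so b(w) = x'(w). *)
have b0 : b w != 0.
  have [x0 _] := sheet_dx0 shw; apply: contra_neq x0 => b0.
  have hzw : holomorphic_at (fun z : C => z - w) w.
    exact: (holomorphicB (holomorphic_id w) (holomorphic_cst w w)).
  have := derive1_mul hzw hb.
  rewrite (_ : (fun z => (z - w) * b z) = (fun z => x z - x w)); last first.
    by apply/funext => z; rewrite bE.
  rewrite (derive1_sub hx (holomorphic_cst (x w) w)) derive1_cst b0 subrr.
  have alg (a1 c d : C) : a1 - 0 = c * 0 + 0 * d -> a1 = 0.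
    by rewrite subr0 mulr0 mul0r addr0.
  exact: alg.
have hV := holomorphicV hb b0.
exists (fun z => a z / b z); first exact: (holomorphicM ha hV).
have near_b : \forall z \near w, b z != 0.
  have [/derivable1_diffP/differentiable_continuous b_cont _] := holomorphic_is_derive hb.
  exact: (cvgr_neq0 _ b_cont b0).
apply: filterS near_b => z bz; rewrite bE.
rewrite (_ : (z - w) * b z * (a z / b z) = (z - w) * a z); last by field.
by rewrite -aE addrC subrK.
Qed.

(* F - F(w) is divisible by x - x(w), which the composition sends to 0 at w.  *)
Lemma comp_mul F f k : holomorphic_at F w -> uniform f ->
  M (L (fun k z => F z * f k z)) k w = F w * M (L f) k w.
Proof.
move=> hF uf; have [q hq qE] := divide_x hF.
have uqf := uniformM hq uf; have uxqf := uniformM hx uqf.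
have ucst c g : uniform g -> uniform (fun k z => c * g k z).
  by move=> ug; exact: (uniformM (holomorphic_cst c w) ug).
transitivity (M (L (fun k z => F w * f k z + (x z * (q z * f k z) + - x w * (q z * f k z)))) k w).
  by apply: comp_near; apply: filterS qE => z -> i; ring.
have u2 : uniform (fun k z => x z * (q z * f k z) + - x w * (q z * f k z)).
  by apply: filterS2 uxqf (ucst (- x w) _ uqf) => z; exact: hol_seqD.
rewrite (comp_D k (ucst (F w) _ uf) u2) (comp_D k uxqf (ucst (- x w) _ uqf)).
rewrite (comp_Z (F w) k uf) (comp_Z (- x w) k uqf) (comp_mulx k uqf).
by rewrite mulNr subrr addr0.
Qed.

Lemma derive1_mulx_div f i z : sheet x y A s z -> holomorphic_at (f i) z ->
  derive1 (fun z => x z * f i z) z / derive1 x z =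
  f i z + x z * (derive1 (f i) z / derive1 x z).
Proof.
move=> shz hf; have [x0 _] := sheet_dx0 shz.
have [hxz _ _ _ _] := shz; rewrite (derive1_mul hxz hf).
have alg (a b c d : C) : a != 0 -> (a * b + c * d) / a = b + c * (d / a).
  by move=> a0; field.
exact (alg _ _ _ _ x0).
Qed.

Lemma uniform_seq0 F : holomorphic_at F w -> uniform (seq0 F).
Proof.
move=> /holomorphic_near; apply: filterS => z hz [|i]; first exact: hz.
exact: holomorphic_cst.
Qed.

Lemma dual_muly f k : uniform f -> M (fun k z => y z * L f k z) k w =
  M (L (fun k z => y z * f k z)) k w +
  sh (fun k => M (L (fun k z => derive1 (f k) z / derive1 x z)) k w) k.
Proof.
move=> uf; have uyf := uniformM hy uf; have udf := uniform_divx uf.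
rewrite -(comp_hshift _ k) trans_hshift_fun.
have h1 := uniform_hol (uniform_trans uyf).
have h2 := hol_seq_hshift (uniform_hol (uniform_trans udf)).
rewrite /trans_dual -(transD _ _ _ _ k h1 h2); apply: trans_near.
apply: filterS2 (sheet_near shw) uf => z shz fz i.
rewrite (trans_ibp shz i fz); congr (_ + _).
by rewrite -trans_hshift trans_hshift_fun.
Qed.

(* The Euler identities for the two transforms show that their composition    *)
(* commutes with the Euler operator in hbar, up to multiplication by A.       *)
Lemma comp_seq0_euler F k : holomorphic_at F w -> k.*2%:R * M (L (seq0 F)) k w = 0.
Proof.
move=> hF; set f := seq0 F; have uf : uniform f := uniform_seq0 hF.
have uxf := uniformM hx uf; have uyf := uniformM hy uf; have uAf := uniformM hA uf.
have udf := uniform_divx uf.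
pose g := L f; have hg : hol_seq g w := uniform_hol (uniform_trans uf).
pose B z := x z * y z - A z.
have hB : holomorphic_at B w by exact: (holomorphicB (holomorphicM hx hy) hA).
pose kg i z := i%:R * g i z.
have hkg : hol_seq kg w by move=> i; exact: (holomorphicM (holomorphic_cst _ _) (hg i)).
pose G i z := i.*2.+1%:R * g i z.
(* The amplitude is constant in hbar, so the Euler term of the inner transform drops out. *)
have kf0 : (fun i z => i%:R * f i z) = fun _ _ => 0.
  by apply/funext => -[|i]; apply/funext => z; rewrite ?mul0r// mulr0.
pose g1 := L (fun k z => x z * f k z).
have hg1 : hol_seq g1 w := uniform_hol (uniform_trans uxf).
pose gA := L (fun k z => A z * f k z).
have hgA : hol_seq gA w := uniform_hol (uniform_trans uAf).
have hZ c h : hol_seq h w -> hol_seq (fun k z => c * h k z) w.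
  by move=> hh; exact: hol_seqM (holomorphic_cst c w) hh.
have E1 : \forall z \near w, forall i, hshift G i z =
    - 2 * gA i z + (2 * (y z * g1 i z) + - 2 * (B z * g i z)).
  apply: filterS2 (sheet_near shw) uf => z shz fz i.
  have := trans_euler shz i fz; rewrite kf0.
  have -> : sh (fun k => L (fun _ _ => 0) k z) i = 0 by case: i => //= i; exact: trans0.
  have -> : sh (fun k => k.*2.+1%:R * L f k z) i = hshift G i z by case: i.
  move=> ->; rewrite /gA /g1 /B /g; ring.
have hyg1 := hol_seqM hy hg1; have hBg := hol_seqM hB hg.
(* The shift on the left of [E1] pairs order k + 1 on the right with order k on the left. *)
have Eb : 2 * M kg k w + M g k w =
    - 2 * M gA k.+1 w + (2 * M (fun k z => y z * g1 k z) k.+1 w +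
       - 2 * M (fun k z => B z * g k z) k.+1 w).
  have := trans_near y (fun z => - x z) (fun z => A z - x z * y z) (fun z => - 'i * s z) k.+1 E1.
  rewrite trans_hshift /= (transD _ _ _ _ _ (hZ _ _ hgA) (hol_seqD (hZ 2 _ hyg1) (hZ (- 2) _ hBg))).
  rewrite (transD _ _ _ _ _ (hZ 2 _ hyg1) (hZ (- 2) _ hBg)).
  rewrite (transZ _ _ _ _ _ _ hgA) (transZ _ _ _ _ _ _ hyg1) (transZ _ _ _ _ _ _ hBg) => <-.
  rewrite (_ : G = fun k z => 2 * kg k z + g k z).
    by rewrite (transD _ _ _ _ _ (hZ 2 _ hkg) hg) (transZ _ _ _ _ _ _ hkg).
  by apply/funext => i; apply/funext => z; rewrite /G /kg -natr1 -mul2n natrM; ring.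
have Ec : k.*2.+1%:R * M g k w = - 2 * (- 1 * M (fun k z => B z * g k z) k.+1 w
    - (- x w) * M (fun k z => y z * g k z) k.+1 w
    + (y w * (- x w) - (A w - x w * y w)) * M g k.+1 w) + 2 * M kg k w.
  have := trans_euler shd k.+1 hg; rewrite /= => ->.
  rewrite -(transZ _ _ _ _ _ _ hBg); congr (- 2 * (_ - _ + _) + _); congr trans.
  by apply/funext => i; apply/funext => z; rewrite /B; ring.
have Ed := dual_muly k.+1 uf; have Ed1 := dual_muly k.+1 uxf; rewrite /= in Ed Ed1.
have EA : M gA k.+1 w = A w * M g k.+1 w := comp_mul k.+1 hA uf.
have Exy : M (L (fun k z => y z * (x z * f k z))) k.+1 w =
    x w * M (L (fun k z => y z * f k z)) k.+1 w.
  rewrite -(comp_mulx k.+1 uyf); apply: comp_near; near=> z => i; exact: mulrCA.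
have Edx : M (L (fun k z => derive1 (fun z => x z * f k z) z / derive1 x z)) k w =
    M g k w + x w * M (L (fun k z => derive1 (f k) z / derive1 x z)) k w.
  rewrite -(comp_mulx k udf) -(comp_D k uf (uniformM hx udf)); apply: comp_near.
  apply: filterS2 (sheet_near shw) uf => z shz fz i.
  exact: (derive1_mulx_div shz (fz i)).
rewrite Exy Edx in Ed1.
(* In the sum of the two Euler identities the terms in B, in A and in y cancel. The extra [Tk] in
   [My1], from the derivative of x f by x, accounts for the units in the two operators t d/dt + 1,
   so that only c = 2k is left. *)
have alg (c Mkg Tk TK MB My My1 X Y a Ty Td MA : C) :
    2 * Mkg + Tk = - 2 * MA + (2 * My1 + - 2 * MB) ->
    (1 + c) * Tk = - 2 * (- 1 * MB - (- X) * My + (Y * (- X) - (a - X * Y)) * TK) + 2 * Mkg ->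
    My = Ty + Td -> My1 = X * Ty + (Tk + X * Td) -> MA = a * TK -> c * Tk = 0.
  move=> H1 H2 H3 H4 H5.
  have -> : c * Tk = (1 + c) * Tk + (2 * Mkg + Tk) - 2 * Tk - 2 * Mkg by ring.
  by rewrite H2 H1 H3 H4 H5; ring.
apply: (alg _ _ _ _ _ _ _ _ _ _ _ _ _ Eb _ Ed Ed1 EA).
by rewrite nat1r Ec.
Unshelve. all: by end_near. Qed.

(** For k > 0 the factor 2k is invertible. For k = 0 the two Gaussian factors x' sqrt(2 pi) / (i s)
    and y' sqrt(2 pi) / s multiply to 2 pi / i, as s^2 = x' y'. *)
Lemma comp_seq0 F k : holomorphic_at F w ->
  M (L (seq0 F)) k w = sqrt2pi ^+ 2 / 'i * seq0 F k w.
Proof.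
move=> hF; case: k => [|k]; last first.
  rewrite [RHS]mulr0; have /eqP := comp_seq0_euler k.+1 hF.
  by rewrite mulf_eq0 pnatr_eq0 doubleS /= => /eqP.
rewrite [LHS](saddle_op0 y (fun z => - x z) (fun z => A z - x z * y z) (fun z => - 'i * s z) w).
rewrite [L (seq0 F) 0%N w](saddle_op0 x y A s w).
have [_ _ _ _ /nbhs_singleton [_ s2 s0]] := shw.
have alg (a b c d q : C) : d ^+ 2 = a * b -> d != 0 ->
   c * a * (q / ('i * d)) * b * (q / ('i * (- 'i * d))) = q ^+ 2 / 'i * c.
  move=> dab d0; have i0 : 'i != 0 :> C by rewrite neq0Ci.
  have -> : 'i * (- 'i * d) = d by rewrite mulrA mulrN -expr2 sqrCi opprK mul1r.
  have -> : c * a * (q / ('i * d)) * b * (q / d) = c * (a * b) * (q ^+ 2 / ('i * d ^+ 2)).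
    by field; rewrite i0 d0.
  by rewrite -dab; field; rewrite i0 d0.
exact (alg _ _ _ _ _ s2 s0).
Qed.

(** Split f into f_0 and hbar times the shifted sequence. Finitely many such splittings reach order
    k, so no hbar-adic limit is involved. *)
Lemma comp_id f k : uniform f -> M (L f) k w = sqrt2pi ^+ 2 / 'i * f k w.
Proof.
elim: k f => [|k IH] f uf;
  have h0 : holomorphic_at (f 0%N) w by exact: uniform_hol uf 0%N.
- have us : uniform (fun i => f i.+1) by apply: filterS uf => z fz i; exact: fz.
  have uh : uniform (hshift (fun i => f i.+1)) by apply: filterS us => z; exact: hol_seq_hshift.
  rewrite -(comp_seq0 0 h0) -[RHS]addr0.
  rewrite -[X in _ = _ + X]/(sh (fun k => M (L (fun i => f i.+1)) k w) 0) -comp_hshift.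
  rewrite -(comp_D 0 (uniform_seq0 h0) uh); apply: comp_near; near=> z => -[|i] /=.
    by rewrite addr0.
  by rewrite add0r.
have us : uniform (fun i => f i.+1) by apply: filterS uf => z fz i; exact: fz.
have uh : uniform (hshift (fun i => f i.+1)) by apply: filterS us => z; exact: hol_seq_hshift.
rewrite -(IH _ us) -[RHS]add0r.
rewrite -[X in _ = _ + X]/(sh (fun k => M (L (fun i => f i.+1)) k w) k.+1) -comp_hshift.
have := comp_seq0 k.+1 h0; rewrite [X in _ = X]mulr0 => <-.
rewrite -(comp_D k.+1 (uniform_seq0 h0) uh); apply: comp_near; near=> z => -[|i] /=.
  by rewrite addr0.
by rewrite add0r.
Unshelve. all: by end_near. Qed.

End Composition.

End Inversion.

(** * Meromorphic amplitudes *)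

Section Locality.
Context {R : realType}.
Local Notation C := (Cplx R).
Implicit Types (F G u Phi x y A s : C -> C) (f g : nat -> C -> C) (p c z w : C) (n k : nat).

Local Opaque holomorphic_at derive1.

Lemma ser_mul_trunc (P P' Q : nat -> {poly C}) n : (forall i, (i <= n)%N -> P i = P' i) ->
  ser_mul P Q n = ser_mul P' Q n.
Proof.
by move=> PP'; apply: eq_bigr => i _; rewrite PP'// -ltnS.
Qed.

(* Meromorphic amplitudes are holomorphic near a given point one at a time,   *)
(* but not uniformly in k.                                                    *)
Lemma trans_trunc x y A s f g k z : (forall i, (i <= k)%N -> f i = g i) ->
  trans x y A s f k z = trans x y A s g k z.
Proof.
move=> fg; rewrite /trans /saddle_op /saddle_series !FG_intE; congr (FG _ _).
rewrite 2![ser_mul (ser_exp _) _]ser_mulC; apply: ser_mul_trunc => m mk.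
apply: ser_mul_trunc => j jm; rewrite /taylor_hbar; apply: eq_bigr => i ij.
by rewrite fg//; rewrite -leq_double (leq_trans ij)// (leq_trans jm).
Qed.

Lemma FG_moment_opp (r : C) m : FG_moment (- r) m = - FG_moment r m.
Proof.
rewrite /FG_moment; case: ifPn => om; first by rewrite oppr0.
by rewrite exprNn -signr_odd /= om expr1 mulN1r invrN mulrN.
Qed.

Lemma FG_opp (r : C) (E Q t1 t2 : nat -> {poly C}) n : t1 = (- 1) *: t2 ->
  FG (- r) (ser_mul E (ser_mul Q t1) n) = FG r (ser_mul E (ser_mul Q t2) n).
Proof.
move=> ->; rewrite !ser_mulZr ser_scaleE FG_scale mulN1r /FG -sumrN.
by apply: eq_bigr => m _; rewrite FG_moment_opp mulrN opprK.
Qed.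

(** The double dual of a sheet is (-x, -y) with root - s, not the sheet itself. The phase is the
    same, and the signs of x' and of the Gaussian moments, which are odd in the root, cancel. *)
Lemma trans_opp x y A s f k p : holomorphic_at x p ->
  trans (fun z => - x z) (fun z => - y z) A (fun z => - s z) f k p = trans x y A s f k p.
Proof.
move=> hx; rewrite /trans /saddle_op /saddle_series !FG_intE.
have -> : phase_at (fun z => - x z) (fun z => - y z) A p = phase_at x y A p.
  by apply/funext => z; rewrite /phase_at mulrNN.
rewrite mulrN; apply: FG_opp.
rewrite -(taylorZ (- 1) (holomorphic_derive1 hx)); apply: taylor_near.
apply: filterS (holomorphic_near hx) => z hz; rewrite (derive1_opp hz).
have alg (a : C) : - a = - 1 * a by rewrite mulN1r.
exact (alg _).
Qed.

Lemma near_forall_le (F : set_system C) (HF : Filter F) (P : nat -> C -> Prop) k :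
  (forall i, (i <= k)%N -> \forall z \near F, P i z) ->
  \forall z \near F, forall i, (i <= k)%N -> P i z.
Proof.
elim: k => [|k IH] H.
  by apply: filterS (H 0%N (leqnn _)) => z Pz i; rewrite leqn0 => /eqP ->.
apply: filterS2 (IH _) (H k.+1 (leqnn _)) => [z Pz Pk i|i ik].
  by rewrite leq_eqVlt => /predU1P[->//|]; exact: Pz.
exact: H (leqW ik).
Qed.

(** Replacing the amplitudes beyond k by 0 leaves order k unchanged and yields a uniform sequence.
    The scalar c makes room for the prefactor of the inner transform. *)
Lemma trans_dual_trans c x y A s f k w : sheet x y A s w ->
  (forall j, (j <= k)%N -> holomorphic_at (f j) w) ->
  trans_dual x y A s (fun j z => c * trans x y A s f j z) k w =
  c * (sqrt2pi ^+ 2 / 'i) * f k w.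
Proof.
move=> shw hf; pose g j : C -> C := if (j <= k)%N then f j else fun=> 0.
have gf j : (j <= k)%N -> f j = g j by rewrite /g => ->.
have ug : uniform w g.
  have H : forall i, (i <= k)%N -> \forall z \near w, holomorphic_at (g i) z.
    by move=> i ik; rewrite -gf//; exact: holomorphic_near (hf i ik).
  apply: filterS (near_forall_le _ H) => z Hz j.
  have [jk|kj] := leqP j k; first exact: Hz.
  by rewrite /g leqNgt kj; exact: holomorphic_cst.
rewrite /trans_dual (@trans_trunc _ _ _ _ _ (fun j z => c * trans x y A s g j z)).
  rewrite (transZ _ _ _ _ c k (uniform_hol (uniform_trans shw ug))).
  rewrite -[X in c * X]/(trans_dual x y A s (trans x y A s g) k w) (comp_id shw k ug).
  by rewrite gf// mulrA.
move=> i ik; apply/funext => z; congr (_ * _); apply: trans_trunc => j ji.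
by rewrite gf// (leq_trans ji).
Qed.

Lemma meromorphic_derive1n n F p : meromorphic_at F p -> meromorphic_at (derive1n n F) p.
Proof. by move=> mF; elim: n => [|n IH]; [exact: mF|exact: (meromorphic_derive1 IH)]. Qed.

Lemma meromorphic_trans x y A s f k p : sheet x y A s p ->
  (forall j, meromorphic_at (f j) p) -> meromorphic_at (trans x y A s f k) p.
Proof.
move=> [hx hy hA hs H] mf.
apply: (class_trans (meromorphic_class p) k hx hA).
- exact: (holomorphic_meromorphic hy).
- by move=> n; exact: (holomorphic_meromorphic (holomorphic_derive1n n hx)).
- by move=> n; exact: (holomorphic_meromorphic (holomorphic_derive1n n hA)).
- by move=> j n; exact: (meromorphic_derive1n n (mf j)).
apply: holomorphic_meromorphic; apply: (holomorphicV hs).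
by have [_ _ ->] := nbhs_singleton H.
Qed.

Lemma sqrt2pi_neq0 : sqrt2pi != 0 :> C.
Proof.
rewrite /sqrt2pi -[0]/((0 : R)%:C%C) (inj_eq (@complexI R)).
by rewrite gt_eqF// sqrtr_gt0 pmulrn_lgt0// pi_gt0.
Qed.

Lemma ampl_Laplace x y s (psi : wave R) k :
  ampl (Laplace x y s psi) k =
  fun z => sqrt2pi^-1 * trans x y (phase psi) s (ampl psi) k z.
Proof. by []. Qed.

Lemma ampl_Laplace_inv x y s (psi : wave R) k :
  ampl (Laplace_inv x y s psi) k = fun z => 'i / sqrt2pi *
    trans y (fun z => - x z) (phase psi) (fun z => - 'i * s z) (ampl psi) k z.
Proof.
apply/funext => w.
have H : saddle_int (fun z => phase psi z + x w * y z) (ampl psi) (derive1 y) w (s w) k.*2 =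
    trans y (fun z => - x z) (phase psi) (fun z => - 'i * s z) (ampl psi) k w.
  rewrite /trans /saddle_op (_ : 'i * (- 'i * s w) = s w); last first.
    by rewrite mulrA mulrN -expr2 sqrCi opprK mul1r.
  rewrite (_ : phase_at y (fun z => - x z) (phase psi) w = fun z => phase psi z + x w * y z)//.
  by apply/funext => z; rewrite /phase_at mulrN opprK mulrC.
exact (congr1 (fun t => 'i / sqrt2pi * t) H).
Qed.

Lemma sheet_branch (D : set C) x y A s (Phi : C -> C) c p : open D -> D p ->
  holomorphic_on D x -> holomorphic_on D y -> holomorphic_on D A ->
  (forall z, D z -> derive1 A z = y z * derive1 x z) -> sqrt_branch D x y s ->
  (forall z, D z -> Phi z = c + A z) -> sheet x y Phi s p.
Proof.
move=> oD Dp hx hy hA dA [hs s2] PhiE.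
have nD : \forall z \near p, D z by exact: open_nbhs_nbhs.
have nE q : D q -> \forall z \near q, c + A z = Phi z.
  move=> Dq; have : \forall z \near q, D z by exact: open_nbhs_nbhs.
  by apply: filterS => z Dz; rewrite PhiE.
have hcA q : D q -> holomorphic_at (fun z => c + A z) q.
  by move=> Dq; exact: (holomorphicD (holomorphic_cst c q) (hA q Dq)).
split; [exact: hx|exact: hy|exact: (holomorphic_ext (nE p Dp) (hcA p Dp))|exact: hs|].
apply: filterS nD => z Dz; have [xy0 sz] := s2 z Dz; split; [|exact: sz|].
  rewrite -(derive1_near (nE z Dz)) -(dA z Dz).
  have := derive1nD 1 (holomorphic_cst c z) (hA z Dz).
  rewrite derive1n_cst => H; apply: etrans H _.
  have alg (a : C) : 0 + a = a by rewrite add0r.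
  exact (alg _).
apply: contra_neq xy0 => s0.
by move: sz; rewrite s0 expr0n /= => <-.
Qed.

End Locality.

Theorem lemma3p2 (R : realType) (S : spectral_curve R)
  (U V D : set (Cplx R)) (x y A B s : Cplx R -> Cplx R)
  (openU : open U) (openV : open V) (openD : open D) (DUV : D `<=` U `&` V)
  (x_branch : coordinate_branch (U `|` V) (sc_dx S) x)
  (y_branch : coordinate_branch (U `|` V) (sc_dy S) y)
  (AB_prim : normalised_primitives D x y A B)
  (s_branch : sqrt_branch D x y s) :
  (forall psi : wave R, wave_space D A psi ->
     wave_space D (\- B) (Laplace x y s psi) /\
     wave_eq D (Laplace_inv x y s (Laplace x y s psi)) psi) /\
  (forall psi : wave R, wave_space D (\- B) psi ->
     wave_space D A (Laplace_inv x y s psi) /\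
     wave_eq D (Laplace x y s (Laplace_inv x y s psi)) psi).
Proof.
have [[hA hB] dA dB AB] := AB_prim.
have hx : holomorphic_on D x by move=> p /DUV[Up _]; apply: x_branch.1; left.
have hy : holomorphic_on D y by move=> p /DUV[Up _]; apply: y_branch.1; left.
(* [mero_eq] asks for a punctured neighbourhood for each k separately, so avoiding the poles of the
   amplitudes 0, ..., k is enough. *)
have near_hol f k p : D p -> (forall j, meromorphic_at (f j) p) ->
    \forall z \near p^', D z /\ forall j, (j <= k)%N -> holomorphic_at (f j) z.
  move=> Dp mf; apply: filterI; first exact/nbhs_dnbhs/open_nbhs_nbhs.
  apply: (near_forall_le (F := p^') (P := fun j z => holomorphic_at (f j) z) _) => j _.
  exact: (meromorphic_holomorphic_near (mf j)).
have q0 := @sqrt2pi_neq0 R.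
have i0 : 'i != 0 :> Cplx R by exact: neq0Ci.
split=> psi [[c phiE] mpsi].
  have shp p : D p -> sheet x y (phase psi) s p.
    by move=> Dp; exact: (sheet_branch openD Dp hx hy hA dA s_branch phiE).
  split; split.
  - exists c => z Dz; rewrite /= phiE// -(AB z Dz) opprD addrA addrK.
    by [].
  - move=> k p Dp; rewrite ampl_Laplace; apply: meromorphicM.
      exact (holomorphic_meromorphic (holomorphic_cst _ p)).
    exact: (meromorphic_trans k (shp p Dp) (fun j => mpsi j p Dp)).
  - by move=> z Dz /=; rewrite subrK.
  move=> k p Dp; apply: filterS (near_hol _ k _ Dp (fun j => mpsi j p Dp)) => z [Dz hz].
  rewrite ampl_Laplace_inv (_ : ampl (Laplace x y s psi) =
    fun j z => sqrt2pi^-1 * trans x y (phase psi) s (ampl psi) j z)//.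
  rewrite -[X in _ * X]/(trans_dual x y (phase psi) s _ k z).
  rewrite (trans_dual_trans _ (shp z Dz) hz).
  have alg (q a : Cplx R) : q != 0 -> 'i / q * (q^-1 * (q ^+ 2 / 'i) * a) = a.
    by move=> qn0; field; rewrite qn0 i0.
  exact: alg.
(* Here psi has phase c - B; the original sheet is recovered from the phase of its inverse
   transform. *)
have phiE' z : D z -> phase psi z + x z * y z = c + A z.
  by move=> Dz; rewrite phiE//= -(AB z Dz) -addrA; congr (_ + _); rewrite addrC addrK.
have shp p : D p -> sheet x y (fun z => phase psi z + x z * y z) s p.
  by move=> Dp; exact: (sheet_branch openD Dp hx hy hA dA s_branch phiE').
have shdp p : D p -> sheet y (fun z => - x z) (phase psi) (fun z => - 'i * s z) p.
  move=> Dp; have := sheet_dual (shp p Dp).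
  by rewrite (_ : (fun z => _ - _) = phase psi)//; apply/funext => z; rewrite addrK.
split; split.
- by exists c => z Dz /=; exact: phiE'.
- move=> k p Dp; rewrite ampl_Laplace_inv; apply: meromorphicM.
    exact (holomorphic_meromorphic (holomorphic_cst _ p)).
  exact: (meromorphic_trans k (shdp p Dp) (fun j => mpsi j p Dp)).
- by move=> z Dz /=; rewrite addrK.
move=> k p Dp; apply: filterS (near_hol _ k _ Dp (fun j => mpsi j p Dp)) => z [Dz hz].
rewrite ampl_Laplace (_ : ampl (Laplace_inv x y s psi) = fun j z => 'i / sqrt2pi *
  trans y (fun z => - x z) (phase psi) (fun z => - 'i * s z) (ampl psi) j z); last first.
  by apply/funext => j; exact: ampl_Laplace_inv.
(* The inner transform lives on the dual sheet, so the outer one is rewritten as that of the double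
   dual, making the composition an instance of [trans_dual_trans]. *)
rewrite -(trans_opp _ _ _ _ _ (hx z Dz)).
have := trans_dual_trans ('i / sqrt2pi) (shdp z Dz) hz; rewrite /trans_dual.
rewrite (_ : (fun z => phase psi z - y z * - x z) = phase (Laplace_inv x y s psi)); last first.
  by apply/funext => w; rewrite /= mulrN opprK mulrC.
rewrite (_ : (fun z => - 'i * (- 'i * s z)) = (fun z => - s z)); last first.
  by apply/funext => w; rewrite mulrA mulrNN -expr2 sqrCi mulN1r.
move=> ->.
have alg (q a : Cplx R) : q != 0 -> q^-1 * ('i / q * (q ^+ 2 / 'i) * a) = a.
  by move=> qn0; field; rewrite qn0 i0.
exact: alg.
Qed.
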